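(* Let $\varphi$ be a linear $\mathrm{G}_2$-structure on the $7$-dimensional real vector space $\mathbb{V}$, and let $\mathbb{U}\subset\mathbb{V}$ be an isotropic $3$-dimensional subspace. Take any basis $U_1,U_2,U_3$ of $\mathbb{U}$. Then $$\varphi=-(\det A)^{-1}\alpha^{123}+\alpha^i\wedge\omega_i,\qquad *\varphi=-\beta\wedge\theta^{123}+\frac12\varepsilon_{ijk}\,\alpha^{ij}\wedge\tilde\omega^k,$$ where the triples of $2$-forms $$\omega_i=\frac12\varepsilon_{ijk}\theta^{jk}-(\det A)^{-1}A_{ip}\,\beta\wedge\theta^p,\qquad \tilde\omega^i=-\frac12\varepsilon_{pqr}A^{ip}\theta^{qr}+(\det A)^{-1}\beta\wedge\theta^i$$ satisfy $$\omega_i\wedge\omega_j=2(\det A)^{-1}A_{ij}\,\theta^{123}\wedge\beta=2(\det A)^{-7/6}\frac{A_{ij}}{(\det A)^{1/3}}\,\mathrm{vol}_{\mathbb{U}}\wedge\beta,$$ $$\tilde\omega^i\wedge\tilde\omega^j=2(\det A)^{-1}A^{ij}\,\theta^{123}\wedge\beta=2(\det A)^{-11/6}\frac{A^{ij}}{(\det A)^{-1/3}}\,\mathrm{vol}_{\mathbb{U}}\wedge\beta,$$ i.e. the triples $(\omega_1,\omega_2,\omega_3)$ and $(\tilde\omega^1,\tilde\omega^2,\tilde\omega^3)$ are definite on $\mathbb{K}_{\mathbb{U}}$.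
   Context: A linear $\mathrm{G}_2$-structure on a $7$-dimensional real vector space $\mathbb{V}$ is a $3$-form $\varphi\in\Lambda^3\mathbb{V}^*$ which in some basis of $\mathbb{V}^*$ equals $e^{123}-e^1(e^{45}+e^{67})-e^2(e^{46}+e^{75})-e^3(e^{47}+e^{56})$ (wedges omitted). It determines an inner product and orientation by $g_\varphi(u,v)\,\mathrm{vol}_\varphi=\frac16(u\lrcorner\varphi)\wedge(v\lrcorner\varphi)\wedge\varphi$; $*$ is the Hodge star. A subspace $\mathbb{W}$ is isotropic if $\varphi|_{\mathbb{W}}=0$. Summation over repeated indices in $\{1,2,3\}$ is understood; $\varepsilon$ is the Levi-Civita symbol; $\alpha^{ij}=\alpha^i\wedge\alpha^j$, $\theta^{123}=\theta^1\wedge\theta^2\wedge\theta^3$ etc. For the basis $U_1,U_2,U_3$: $A_{ij}=g_\varphi(U_i,U_j)$, $(A^{ij})=A^{-1}$; $\alpha^i=\frac12\varepsilon^{ijk}\varphi(U_j,U_k,\cdot)$; $\beta=( *\varphi)(U_1,U_2,U_3,\cdot)$; $\theta^i\in\mathbb{V}^*$ are defined by $\theta^i(U_j)=\delta^i_j$ and $\theta^i=0$ on the $g_\varphi$-orthogonal complement $\mathbb{U}^{\perp_{g_\varphi}}$; $\mathrm{vol}_{\mathbb{U}}=(\det A)^{1/2}\theta^{123}$. $\mathbb{K}_{\mathbb{U}}=\ker\alpha^1\cap\ker\alpha^2\cap\ker\alpha^3$, a $4$-dimensional subspace (containing $\mathbb{U}$ here). A triple of $2$-forms $(\omega_1,\omega_2,\omega_3)$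 is definite on a $4$-dimensional space if, for a volume form $\mu$ on it, the matrix $\left(\frac{\omega_i\wedge\omega_j}{2\mu}\right)$ (of restrictions) is definite. *)

(* Defs.v *)
From HB Require Import structures.
From mathcomp Require Import all_boot all_order all_fingroup all_algebra.
From mathcomp Require Import all_classical all_reals all_analysis.

Set Implicit Arguments.
Unset Strict Implicit.
Unset Printing Implicit Defensive.
Import Order.TTheory GRing.Theory Num.Theory.

Local Open Scope ring_scope.

(* Covariant k-tensors on V, with pointwise module structure; the k-forms are
   those satisfying [is_alternating]. *)
Definition kform (R : realType) (V : vectType R) (k : nat) : Type :=
  ('I_k -> V) -> R^o.

#[warnings="-redundant-canonical-projection"]
HB.instance Definition _ (R : realType) (V : vectType R) (k : nat) :=
  GRing.Lmodule.copy (kform V k) (('I_k -> V) -> R^o).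

Definition is_alternating (R : realType) (V : vectType R) (k : nat)
    (a : kform V k) : Prop :=
  (forall (v : 'I_k -> V) (i : 'I_k) (c : R) (x y : V),
     a [eta v with i |-> c *: x + y] =
     c * a [eta v with i |-> x] + a [eta v with i |-> y]) /\
  (forall (v : 'I_k -> V) (i j : 'I_k), i != j -> v i = v j -> a v = 0).

Definition covector (R : realType) (V : vectType R) (f : 'Hom(V, R^o)) :
    kform V 1 :=
  fun v => f (v ord0).

(* Normalised so that (e^1 /\ e^2)(u, v) = e^1(u) e^2(v) - e^1(v) e^2(u). *)
Definition wedge_form (R : realType) (V : vectType R) (k l : nat)
    (a : kform V k) (b : kform V l) : kform V (k + l) :=
  fun v => (k`!%:R * l`!%:R)^-1 *
    \sum_(s : 'S_(k + l)) (-1) ^+ s *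
      (a (fun i => v (s (lshift l i))) * b (fun j => v (s (rshift k j)))).

Notation "a ∧ b" := (wedge_form a b) (at level 33, left associativity)
  : ring_scope.

(* Interior product: u is inserted in the first slot. *)
Definition interior_product (R : realType) (V : vectType R) (k : nat)
    (u : V) (a : kform V k.+1) : kform V k :=
  fun v => a (fun i => oapp v u (unlift ord0 i)).

Notation "u ⌟ a" := (interior_product u a) (at level 32, right associativity)
  : ring_scope.

Definition restrict_form (R : realType) (V : vectType R) (W : {vspace V})
    (k : nat) (a : kform V k) : kform (subvs_of W) k :=
  fun w => a (fun i => vsval (w i)).
Arguments restrict_form {R V} W {k} a.

(* In a basis x of V with Gram matrix (g_ij) this is the usual
   ( *a)_{j1..jl} = 1/k! g^{i1 m1} ... g^{ik mk} a_{m1..mk} vol_{i1..ik j1..jl},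
   i.e. b /\ *a = <b, a> vol for all k-forms b; it does not depend on x. *)
Definition hodge_star (R : realType) (V : vectType R) (g : {dot V for idfun})
    (k l : nat) (vol : kform V (k + l)) (a : kform V k) : kform V l :=
  let n := \dim (fullv : {vspace V}) in
  let x := tnth (vbasis (fullv : {vspace V})) in
  let G : 'M[R]_n := \matrix_(i, j) g (x i) (x j) in
  fun w => (k`!%:R)^-1 *
    \sum_(I : {ffun 'I_k -> 'I_n}) \sum_(M : {ffun 'I_k -> 'I_n})
      (\prod_(r < k) invmx G (I r) (M r)) * a (fun r => x (M r)) *
      vol (fun s => match fintype.split s with
                    | inl r => x (I r)
                    | inr t => w t
                    end).

Definition levi_civita (R : realType) (i j k : 'I_3) : R :=
  match val i, val j, val k with
  | 0, 1, 2 | 1, 2, 0 | 2, 0, 1 => 1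
  | 2, 1, 0 | 1, 0, 2 | 0, 2, 1 => -1
  | _, _, _ => 0
  end.

Definition linear_G2_structure (R : realType) (V : vectType R)
    (phi : kform V 3) : Prop :=
  exists2 e : 7.-tuple 'Hom(V, R^o),
    basis_of (fullv : {vspace 'Hom(V, R^o)}) e &
    let e1 := covector e`_0 in let e2 := covector e`_1 in
    let e3 := covector e`_2 in let e4 := covector e`_3 in
    let e5 := covector e`_4 in let e6 := covector e`_5 in
    let e7 := covector e`_6 in
    phi = (e1 ∧ e2 ∧ e3 : kform V 3)
          - (e1 ∧ (e4 ∧ e5 + e6 ∧ e7) : kform V 3)
          - (e2 ∧ (e4 ∧ e6 + e7 ∧ e5) : kform V 3)
          - (e3 ∧ (e4 ∧ e7 + e5 ∧ e6) : kform V 3).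

(* g and vol are the inner product and the oriented volume form determined by
   phi: vol is a Riemannian volume form of g, which fixes the scaling in
   g(u, v) vol = 1/6 (u _| phi) /\ (v _| phi) /\ phi. *)
Definition G2_metric_volume (R : realType) (V : vectType R) (phi : kform V 3)
    (g : {dot V for idfun}) (vol : kform V 7) : Prop :=
  [/\ is_alternating vol,
      (forall x : 7.-tuple V, orthonormal g x -> `|vol (tnth x) : R| = 1) &
      (forall u v : V,
         g u v *: vol = 6^-1 *: ((u ⌟ phi) ∧ (v ⌟ phi) ∧ phi : kform V 7))].

Definition isotropic (R : realType) (V : vectType R) (phi : kform V 3)
    (W : {vspace V}) : Prop :=
  restrict_form W phi = 0.

Definition definite_mx (R : realType) (n : nat) (M : 'M[R]_n) : Prop :=
  (forall x : 'rV[R]_n, x != 0 -> 0 < (x *m M *m x^T) 0 0) \/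
  (forall x : 'rV[R]_n, x != 0 -> (x *m M *m x^T) 0 0 < 0).

Definition definite_triple (R : realType) (V : vectType R) (W : {vspace V})
    (w : 'I_3 -> kform V 2) : Prop :=
  \dim W = 4%N /\
  forall mu : kform (subvs_of W) 4, is_alternating mu -> mu <> 0 ->
    exists2 M : 'M[R]_3,
      (forall i j, (restrict_form W (w i ∧ w j) : kform (subvs_of W) 4) =
                   (2 * M i j) *: mu) &
      definite_mx M.

Section IsotropicBasis.

Variables (R : realType) (V : vectType R) (phi : kform V 3).
Variables (g : {dot V for idfun}) (vol : kform V 7) (U : 3.-tuple V).

Local Notation eps := (@levi_civita R).

Definition gramU : 'M[R]_3 := \matrix_(i, j) g (tnth U i) (tnth U j).

Definition alphaU (i : 'I_3) : kform V 1 :=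
  2^-1 *: \sum_j \sum_k eps i j k *: (tnth U k ⌟ tnth U j ⌟ phi).

Definition star_phi : kform V 4 := hodge_star g (k := 3) (l := 4) vol phi.

Definition betaU : kform V 1 :=
  U`_2 ⌟ U`_1 ⌟ U`_0 ⌟ star_phi.

Definition KU : {vspace V} :=
  (\bigcap_(i < 3) lker (linfun (fun v : V => alphaU i (fun=> v))))%VS.

(* The coframe theta^i is dual to U and kills the orthogonal complement. *)
Definition dual_coframe (theta : 'I_3 -> 'Hom(V, R^o)) : Prop :=
  (forall i j, theta i (tnth U j) = (i == j)%:R) /\
  (forall (i : 'I_3) (v : V), v \in orthov g <<U>>%VS -> theta i v = 0).

Variable theta : 'I_3 -> 'Hom(V, R^o).
Local Notation A := gramU.
Local Notation th i := (covector (theta i)).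

Definition thetaU2 (i j : 'I_3) : kform V 2 := th i ∧ th j.

Definition thetaU123 : kform V 3 := th 0 ∧ th 1 ∧ th 2%:R.

Definition vol_U : kform V 3 := Num.sqrt (\det A) *: thetaU123.

Definition omegaU (i : 'I_3) : kform V 2 :=
  2^-1 *: (\sum_j \sum_k eps i j k *: thetaU2 j k)
  - (\det A)^-1 *: \sum_p A i p *: (betaU ∧ th p : kform V 2).

Definition omega_tildeU (i : 'I_3) : kform V 2 :=
  - (2^-1 *: \sum_p \sum_q \sum_r
       (eps p q r * invmx A i p) *: thetaU2 q r)
  + (\det A)^-1 *: (betaU ∧ th i : kform V 2).

End IsotropicBasis.

(* Main.v *)
Require Import Defs.
From HB Require Import structures.
From mathcomp Require Import all_boot all_order all_fingroup all_algebra.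
From mathcomp Require Import all_classical all_reals all_analysis.
From mathcomp Require Import ring.

Set Implicit Arguments.
Unset Strict Implicit.
Unset Printing Implicit Defensive.
Import Order.TTheory GRing.Theory Num.Theory.

Local Open Scope ring_scope.

(** Both sides of every formula transform in the same way under a change of basis of the
    isotropic subspace, and G2 acts transitively on orthonormal isotropic triples; so the
    theorem reduces to one computation in a frame in which phi has its normal form.

    The metric. In a frame e where phi is standard the 7-form
    (u _| phi) ∧ (v _| phi) ∧ phi is 6 <u, v> e^1..7, with the Euclidean product. Hence g is a
    multiple of that product, and the requirement that vol be a Riemannian volume form of g
    leaves the factor 1 only: the frame is orthonormal and vol = e^1..7
    ([G2_metric_volume_frame]).

    The adapted frame. The cross product defined by <u x v, w> = phi(u, v, w) satisfies
    u x (u x v) = - |u|^2 v + <u, v> u. From this identity alone, an orthonormal triple x, y, z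
    with phi(x, y, z) = 0 generates, together with y x z, z x x, x x y and x x (y x z), an
    orthonormal frame with the same multiplication table as the original one, in which x, y, z
    are e_5, e_6, e_7 ([adapted_frame]). Applied to an orthonormal basis of the isotropic
    subspace, it gives a frame that is standard for phi and adapted to the subspace at once.
    There alpha = - (e^1, e^2, e^3), beta = - e^4 and theta = (e^5, e^6, e^7).

    The computation. In the adapted frame all forms involved, *phi included
    ([star_phi_std]), are integer combinations of monomials e^l. Such combinations are
    represented by lists on which wedge and interior products are computable, and the
    identities are decided by sorting monomials ([denote_eq]).

    The change of basis. If the given basis is P times the orthonormal one and Q = P^-1, the
    Gram matrix is P P^T, and the cofactor identity for the Levi-Civita symbol
    ([levi_civita_change]) shows that alpha, theta, beta, omega and its dual triple carry the
    weights (det P) Q^T, Q^T, det P, (det P)^-1 P and - (det P)^-1 Q^T relative to the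
    orthonormal alpha, theta, beta, omega, omega. In the formulas for phi and *phi these cancel;
    in the wedge squares of the triples they leave (det P)^-2 P P^T and (det P)^-2 Q^T Q, which
    are positive definite. *)

(** * Wedge products and monomials *)

Section Wedge.
Variables (R : realType) (V : vectType R).

Lemma kform_ext k (a b : kform V k) : (forall v, a v = b v :> R) -> a = b.
Proof. by move=> ab; apply/funext. Qed.

Lemma kform_sumE k I (r : seq I) (P : pred I) (F : I -> kform V k) v :
  (\sum_(i <- r | P i) F i) v = \sum_(i <- r | P i) F i v.
Proof. by elim/big_rec2: _ => // i y x _ <-. Qed.

Lemma kformDE k (a b : kform V k) v : (a + b) v = (a v : R) + b v.
Proof. by []. Qed.

Lemma kform0E k v : (0 : kform V k) v = 0 :> R.
Proof. by []. Qed.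

Lemma kformZE k c (a : kform V k) v : (c *: a) v = c * (a v : R).
Proof. by []. Qed.

Lemma wedgeE k l (a : kform V k) (b : kform V l) v : (a ∧ b) v =
  (k`!%:R * l`!%:R)^-1 * \sum_(s : 'S_(k + l)) (-1) ^+ s *
    ((a (fun i => v (s (lshift l i))) : R) * (b (fun j => v (s (rshift k j))) : R)) :> R.
Proof. by []. Qed.

Lemma wedgeDl k l (a b : kform V k) (c : kform V l) :
  (a + b) ∧ c = a ∧ c + b ∧ c.
Proof.
apply: kform_ext => v; rewrite kformDE !wedgeE -mulrDr -big_split /=.
by congr (_ * _); apply: eq_bigr => s _; rewrite -mulrDr -mulrDl.
Qed.

Lemma wedgeDr k l (a : kform V k) (b c : kform V l) :
  a ∧ (b + c) = a ∧ b + a ∧ c.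
Proof.
apply: kform_ext => v; rewrite kformDE !wedgeE -mulrDr -big_split /=.
by congr (_ * _); apply: eq_bigr => s _; rewrite -mulrDr -mulrDr.
Qed.

Lemma wedgeZl k l x (a : kform V k) (b : kform V l) :
  (x *: a) ∧ b = x *: (a ∧ b).
Proof.
apply: kform_ext => v; rewrite kformZE !wedgeE [RHS]mulrCA [X in _ = _ * X]mulr_sumr.
by congr (_ * _); apply: eq_bigr => s _; rewrite kformZE -mulrA mulrCA.
Qed.

Lemma wedgeZr k l x (a : kform V k) (b : kform V l) :
  a ∧ (x *: b) = x *: (a ∧ b).
Proof.
apply: kform_ext => v; rewrite kformZE !wedgeE [RHS]mulrCA [X in _ = _ * X]mulr_sumr.
congr (_ * _); apply: eq_bigr => s _; rewrite kformZE [RHS]mulrCA.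
by congr (_ * _); rewrite mulrCA.
Qed.

Lemma wedge0l k l (a : kform V l) : (0 : kform V k) ∧ a = 0.
Proof. by rewrite -(scale0r 0) wedgeZl scale0r. Qed.

Lemma wedge0r k l (a : kform V k) : a ∧ (0 : kform V l) = 0.
Proof. by rewrite -(scale0r 0) wedgeZr scale0r. Qed.

Lemma wedge_suml k l I (r : seq I) (P : pred I) (F : I -> kform V k)
    (a : kform V l) :
  (\sum_(i <- r | P i) F i) ∧ a = \sum_(i <- r | P i) F i ∧ a.
Proof.
by elim/big_rec2: _ => [|i y x _ <-]; rewrite ?wedge0l ?wedgeDl.
Qed.

Lemma wedge_sumr k l I (r : seq I) (P : pred I) (F : I -> kform V l)
    (a : kform V k) :
  a ∧ (\sum_(i <- r | P i) F i) = \sum_(i <- r | P i) a ∧ F i.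
Proof.
by elim/big_rec2: _ => [|i y x _ <-]; rewrite ?wedge0r ?wedgeDr.
Qed.

Lemma interiorZ k u c (a : kform V k.+1) : u ⌟ (c *: a) = c *: (u ⌟ a).
Proof. by []. Qed.

Lemma interior_sum k u I (r : seq I) (P : pred I) (F : I -> kform V k.+1) :
  u ⌟ (\sum_(i <- r | P i) F i) = \sum_(i <- r | P i) u ⌟ F i.
Proof.
by apply: kform_ext => v; rewrite kform_sumE /interior_product kform_sumE.
Qed.

Variable f : nat -> 'Hom(V, R^o).

(** The form f_(l_0) ∧ ... ∧ f_(l_(k-1)), given at once by a determinant so that repeated and
    unsorted index lists l make sense. *)
Definition monomial k (l : seq nat) : kform V k :=
  fun v => \det (\matrix_(i < k, j < k) f (nth 0%N l i) (v j)).
Arguments monomial k l : clear implicits.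

(** Generalised Laplace expansion. With both determinants expanded over permutations p and q,
    the sum over s is, for fixed p and q, the determinant of the stacked matrix with its two
    blocks of rows permuted by p and q. The two signs cancel against those of the expansion, so
    all k! l! pairs contribute equally and absorb the normalisation of the wedge. *)
Lemma monomial_wedge k m l1 l2 : size l1 = k ->
  monomial k l1 ∧ monomial m l2 = monomial (k + m) (l1 ++ l2).
Proof.
move=> sl1; apply: kform_ext => v; rewrite /wedge_form /monomial.
set M := (\matrix_(i < k + m, j < k + m) _).
pose A := \matrix_(i < k, j < k + m) f (nth 0%N l1 i) (v j).
pose B := \matrix_(i < m, j < k + m) f (nth 0%N l2 i) (v j).
have -> : M = col_mx A B.
  apply/matrixP => i j; rewrite !mxE; case: splitP => r ri; rewrite !mxE ri nth_cat sl1.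
    by rewrite ltn_ord.
  by rewrite ltnNge leq_addr addKn.
have rowpq (p : 'S_k) (q : 'S_m) : \det (col_mx (row_perm p A) (row_perm q B)) =
    (-1) ^+ p * (-1) ^+ q * \det (col_mx A B).
  rewrite !row_permE.
  have -> : col_mx (perm_mx p *m A) (perm_mx q *m B) =
      block_mx (perm_mx p) 0 0 (perm_mx q) *m col_mx A B.
    by rewrite mul_block_col !mul0mx addr0 add0r.
  by rewrite det_mulmx det_ublock !det_perm.
rewrite (eq_bigr (fun s : 'S_(k + m) => \sum_(p : 'S_k) \sum_(q : 'S_m)
   (-1) ^+ p * (-1) ^+ q *
   ((-1) ^+ s * \prod_i (col_mx (row_perm p A) (row_perm q B)) i (s i)))); last first.
  move=> s _; rewrite -det_tr [\det _]/determinant mulr_suml mulr_sumr.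
  apply: eq_bigr => p _; rewrite -det_tr [\det _]/determinant mulr_sumr mulr_sumr.
  apply: eq_bigr => q _; rewrite big_split_ord /=.
  have shuffle (a b c x y : R) : a * (b * x * (c * y)) = b * c * (a * (x * y)) by ring.
  rewrite shuffle; congr (_ * (_ * (_ * _))); apply: eq_bigr => i _.
    by rewrite col_mxEu !mxE.
  by rewrite col_mxEd !mxE.
rewrite exchange_big /= (eq_bigr (fun _ => m`!%:R * \det (col_mx A B))).
  rewrite sumr_const card_Sn -[X in _ * X = _]mulr_natl [X in _ * X = _]mulrA mulKf //.
move=> p _; rewrite exchange_big /= (eq_bigr (fun _ => \det (col_mx A B))).
  by rewrite sumr_const card_Sn mulr_natl.
move=> q _; rewrite -mulr_sumr -/(determinant _) rowpq.
by rewrite mulrA mulrACA -!expr2 !sqrr_sign !mul1r.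
Qed.

End Wedge.
Arguments monomial {R V} f k l : rename.

(** * Deciding identities between integer combinations of monomials *)

Section MonomialCalculus.
Variables (R : realType) (V : vectType R) (f : nat -> 'Hom(V, R^o)).
Local Notation mono := (monomial f).

Lemma monomial0E v : mono 0 [::] v = 1 :> R.
Proof. exact: det_mx00. Qed.

Lemma monomial1E x v : mono 1 [:: x] v = f x (v 0).
Proof. by rewrite /monomial det_mx11 mxE. Qed.

Lemma monomial2E x y v : mono 2 [:: x; y] v =
  f x (v 0) * f y (v 1) - f x (v 1) * f y (v 0) :> R.
Proof.
rewrite /monomial (expand_det_row _ ord0) !big_ord_recl big_ord0 /cofactor.
pose w n := v (inord n); have vw i : v i = w i by rewrite /w inord_val.
by rewrite !det_mx11 !mxE !vw /=; ring.
Qed.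

Lemma monomial3E x y z v : mono 3 [:: x; y; z] v =
  f x (v 0) * (f y (v 1) * f z (v 2%:R) - f y (v 2%:R) * f z (v 1))
  - f x (v 1) * (f y (v 0) * f z (v 2%:R) - f y (v 2%:R) * f z (v 0))
  + f x (v 2%:R) * (f y (v 0) * f z (v 1) - f y (v 1) * f z (v 0)) :> R.
Proof.
rewrite /monomial (expand_det_row _ ord0) !big_ord_recl big_ord0 /cofactor.
rewrite !(expand_det_row _ ord0) !big_ord_recl !big_ord0 /cofactor.
pose w n := v (inord n); have vw i : v i = w i by rewrite /w inord_val.
by rewrite !det_mx11 !mxE !vw /=; ring.
Qed.

Lemma covector_monomial x : covector (f x) = mono 1 [:: x].
Proof. by apply: kform_ext => v; rewrite monomial1E. Qed.

(** Laplace expansion along the first column, the one that holds u. *)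
Lemma monomial_interior u k l : size l = k.+1 ->
  u ⌟ mono k.+1 l = \sum_(r < k.+1)
    ((-1) ^+ r * f (nth 0%N l r) u) *: mono k (take r l ++ drop r.+1 l).
Proof.
move=> sl; apply: kform_ext => v; rewrite kform_sumE /interior_product /monomial.
rewrite (expand_det_col _ ord0); apply: eq_bigr => r _.
rewrite kformZE !mxE unlift_none /= /cofactor addn0 mulrA [X in X * _ = _]mulrC.
congr (_ * \det _); apply/matrixP => i j; rewrite !mxE.
have -> : unlift ord0 (lift ord0 j) = Some j by rewrite liftK.
rewrite /= nth_cat size_take sl ltn_ord; congr (f _ _).
rewrite /bump; case: (ltnP i r) => ri; first by rewrite nth_take // add0n.
by rewrite nth_drop add1n addSn subnKC.
Qed.

Lemma monomial_swap k x y l :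
  mono k.+2 (x :: y :: l) = - mono k.+2 (y :: x :: l).
Proof.
rewrite -[k.+2]/(2 + k)%N -[x :: _]/([:: x; y] ++ l) -[y :: x :: l]/([:: y; x] ++ l).
rewrite -!monomial_wedge // -scaleN1r -wedgeZl; congr (_ ∧ _).
by apply: kform_ext => v; rewrite kformZE !monomial2E; ring.
Qed.

Lemma monomial_dup k x l : mono k.+2 (x :: x :: l) = 0.
Proof.
have /eqP := monomial_swap k x x l; rewrite -subr_eq0 opprK -mulr2n => /eqP h.
by rewrite -[LHS](scalerK (_ : 2%:R != 0 :> R)) ?pnatr_eq0 // scaler_nat h scaler0.
Qed.

Lemma monomial_cons k x l : mono k.+1 (x :: l) = mono 1 [:: x] ∧ mono k l.
Proof. by rewrite monomial_wedge. Qed.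

(** The boolean is the parity of the adjacent swaps made; None signals a repeated index, for
    which the monomial vanishes. *)
Fixpoint insert_index (x : nat) (l : seq nat) : option (bool * seq nat) :=
  if l is y :: l' then
    if (x < y)%N then Some (false, x :: l)
    else if x == y then None
    else if insert_index x l' is Some (s, m) then Some (~~ s, y :: m) else None
  else Some (false, [:: x]).

Fixpoint sort_indices (l : seq nat) : option (bool * seq nat) :=
  if l is x :: l' then
    if sort_indices l' is Some (s, m) then
      if insert_index x m is Some (s', m') then Some (s (+) s', m') else None
    else None
  else Some (false, [::]).

Definition signed_monomial k (o : option (bool * seq nat)) : kform V k :=
  if o is Some (s, m) then (-1) ^+ s *: mono k m else 0.
Arguments signed_monomial k o : clear implicits.

Lemma insert_indexP k x l : size l = k ->
  mono k.+1 (x :: l) = signed_monomial k.+1 (insert_index x l) /\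
  (forall s m, insert_index x l = Some (s, m) -> size m = k.+1).
Proof.
elim: l k => [|y l IHl] k /= sl.
  by subst k; split; [rewrite /= expr0 scale1r | move=> s m [_ <-]].
case: ltnP => [_|_]; first by split; [rewrite /= expr0 scale1r | move=> s m [_ <-] /=; rewrite sl].
case: eqVneq => [->|_].
  by split=> //=; case: k sl => // k _; rewrite monomial_dup.
case: k sl => // k [sl]; have [IH1 IH2] := IHl _ sl.
rewrite monomial_swap monomial_cons IH1; case E: (insert_index x l) => [[s m]|].
  split=> [|s' m' [_ <-] /=]; last by rewrite (IH2 _ _ E).
  by rewrite /= wedgeZr -monomial_cons signrN scaleNr.
by split=> //=; rewrite wedge0r oppr0.
Qed.

Lemma sort_indicesP k l : size l = k ->
  mono k l = signed_monomial k (sort_indices l) /\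
  (forall s m, sort_indices l = Some (s, m) -> size m = k).
Proof.
elim: l k => [|x l IHl] k /= sl.
  by subst k; split; [rewrite /= expr0 scale1r | move=> s m [_ <-]].
case: k sl => // k [sl]; have [IH1 IH2] := IHl _ sl.
rewrite monomial_cons IH1; case E: (sort_indices l) => [[s m]|] /=; last first.
  by split=> //; rewrite wedge0r.
have [I1 I2] := insert_indexP x (IH2 _ _ E).
rewrite wedgeZr -monomial_cons I1; case E': (insert_index x m) => [[s' m']|] /=.
  by split=> [|_ _ [_ <-]]; rewrite ?(I2 _ _ E') // scalerA signr_addb.
by split=> //; rewrite scaler0.
Qed.

(** Integer combinations of monomials as data: in a frame, every identity between forms with
    constant coefficients becomes a computation, by [denote_eq]. *)
Definition combination := seq (int * seq nat).

Definition denote k (p : combination) : kform V k :=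
  \sum_(t <- p) t.1%:~R *: mono k t.2.

End MonomialCalculus.
Arguments denote {R V} f k p : rename.

Definition homogeneous k (p : combination) := all (fun t => size t.2 == k) p.

Definition comb_scale (c : int) (p : combination) : combination :=
  [seq (c * t.1, t.2) | t <- p].

Definition comb_wedge (p q : combination) : combination :=
  [seq (t.1 * u.1, t.2 ++ u.2) | t <- p, u <- q].

(** Contraction with the i-th vector of the dual frame: of the Laplace expansion only the
    positions carrying the index i survive. *)
Definition comb_interior i (p : combination) : combination :=
  flatten [seq [seq (t.1 * (-1) ^+ (odd r), take r t.2 ++ drop r.+1 t.2) |
                 r <- iota 0 (size t.2) & nth 0%N t.2 r == i] | t <- p].

Definition comb_normal (p : combination) : combination :=
  pmap (fun t => omap (fun o => (t.1 * (-1) ^+ (nat_of_bool o.1), o.2)) (sort_indices t.2)) p.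

Definition comb_coef (p : combination) l : int :=
  foldr (fun t s => if t.2 == l then t.1 + s else s) 0 p.

Definition comb_eq (p q : combination) :=
  let r := comb_normal (p ++ comb_scale (-1) q) in
  all (fun t => comb_coef r t.2 == 0) r.

Section Denotation.
Variables (R : realType) (V : vectType R) (f : nat -> 'Hom(V, R^o)).
Local Notation den := (denote f).

Lemma denote_cat k p q : den k (p ++ q) = den k p + den k q.
Proof. exact: big_cat. Qed.

Lemma denote_scale k c p : den k (comb_scale c p) = c%:~R *: den k p.
Proof.
rewrite /denote big_map scaler_sumr; apply: eq_bigr => t _ /=.
by rewrite scalerA -intrM.
Qed.

Lemma denote_flatten k I (r : seq I) (F : I -> combination) :
  den k (flatten [seq F i | i <- r]) = \sum_(i <- r) den k (F i).
Proof. by rewrite /denote big_flatten big_map. Qed.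

Lemma denote_wedge k m p q : homogeneous k p ->
  den k p ∧ den m q = den (k + m) (comb_wedge p q).
Proof.
move=> /allP hp; rewrite /denote big_allpairs_dep wedge_suml [LHS]big_seq [RHS]big_seq.
apply: eq_bigr => t /hp /eqP st.
rewrite wedge_sumr; apply: eq_bigr => u _.
by rewrite wedgeZl wedgeZr scalerA intrM monomial_wedge.
Qed.

Lemma denote_interior (E : nat -> V) k i p :
  (forall j, f j (E i) = (j == i)%:R) -> homogeneous k.+1 p ->
  E i ⌟ den k.+1 p = den k (comb_interior i p).
Proof.
move=> fE /allP hp; rewrite /comb_interior denote_flatten /denote interior_sum.
rewrite [LHS]big_seq [RHS]big_seq; apply: eq_bigr => t /hp /eqP st.
rewrite interiorZ monomial_interior // scaler_sumr big_map big_filter st.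
rewrite -[iota 0 _]/(index_iota 0 k.+1) big_mkord [RHS]big_mkcond /=.
apply: eq_bigr => r _; rewrite fE scalerA.
by case: eqP => _; rewrite ?mulr0 ?scale0r // mulr1 intrM signr_odd rmorphXn rmorphN1.
Qed.

Lemma denote_normal k p : homogeneous k p -> den k (comb_normal p) = den k p.
Proof.
elim: p => //= t p IHp /andP[/eqP st /IHp IH].
have [E _] := sort_indicesP f st.
rewrite [RHS]/denote big_cons -/(den k p) -IH E.
case: (sort_indices t.2) => [[s m]|] /=; last by rewrite scaler0 add0r.
by rewrite [LHS]/denote big_cons /= scalerA intrM rmorphXn rmorphN1.
Qed.

Lemma comb_coefE p l : comb_coef p l = \sum_(t <- p | t.2 == l) t.1.
Proof.
by elim: p => [|t p IHp] /=; rewrite ?big_nil // big_cons IHp.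
Qed.

(** The difference, rewritten with sorted monomials, is regrouped by monomial; the test says
    that every group has total coefficient 0. *)
Lemma denote_eq k p q : homogeneous k p -> homogeneous k q -> comb_eq p q ->
  den k p = den k q.
Proof.
move=> hp hq /allP heq; apply/eqP; rewrite -subr_eq0 -scaleN1r.
have -> : den k p + -1 *: den k q = den k (p ++ comb_scale (-1) q).
  by rewrite denote_cat denote_scale.
rewrite -denote_normal; last first.
  rewrite /homogeneous all_cat; apply/andP; split=> //.
  by rewrite /comb_scale all_map.
set r := comb_normal _ in heq *.
have -> : den k r = \sum_(l <- undup [seq t.2 | t <- r])
    \sum_(t <- r | t.2 == l) t.1%:~R *: monomial f k t.2.
  rewrite (exchange_big_dep predT) //= /denote [LHS]big_seq [RHS]big_seq; apply: eq_bigr => t tr.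
  rewrite (big_rem t.2) /=; last by rewrite mem_undup map_f.
  rewrite eqxx big1_seq ?addr0 // => l /andP[/eqP <-].
  by rewrite mem_rem_uniq ?undup_uniq // !inE eqxx.
rewrite big1_seq // => l /andP[_]; rewrite mem_undup => /mapP[t tr ->].
rewrite (eq_bigr (fun u => u.1%:~R *: monomial f k t.2)); last by move=> u /eqP ->.
have /eqP := heq t tr; rewrite comb_coefE => c0.
by rewrite -scaler_suml -rmorph_sum /= c0 scale0r.
Qed.

End Denotation.

(** * Multilinear and alternating forms *)

Section Multilinear.
Variables (R : realType) (V : vectType R).

Definition multilinear k (a : kform V k) :=
  forall (v : 'I_k -> V) (i : 'I_k) (c : R) (x y : V),
    a [eta v with i |-> c *: x + y] =
    c * a [eta v with i |-> x] + a [eta v with i |-> y] :> R.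

(** Insertion in slot 0, in the form in which the interior product performs it. *)
Definition vcons T k (u : T) (v : 'I_k -> T) : 'I_k.+1 -> T :=
  fun i => oapp v u (unlift ord0 i).

Lemma vcons0 T k (u : T) (v : 'I_k -> T) : vcons u v ord0 = u.
Proof. by rewrite /vcons unlift_none. Qed.

Lemma vconsS T k (u : T) (v : 'I_k -> T) i : vcons u v (lift ord0 i) = v i.
Proof. by rewrite /vcons liftK. Qed.

Lemma vcons_eta T k (v : 'I_k.+1 -> T) :
  v = vcons (v ord0) (fun i => v (lift ord0 i)).
Proof.
by apply/funext => i; case: (unliftP ord0 i) => [j|] ->; rewrite ?vconsS ?vcons0.
Qed.

Lemma interiorE k u (a : kform V k.+1) v : (u ⌟ a) v = a (vcons u v).
Proof. by []. Qed.

Lemma vcons_update k u (v : 'I_k -> V) i x :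
  vcons u [eta v with i |-> x] = [eta vcons u v with lift ord0 i |-> x].
Proof.
apply/funext => j; case: (unliftP ord0 j) => [m|] ->; rewrite ?vconsS ?vcons0 /=.
  by rewrite vconsS (inj_eq lift_inj).
by rewrite vcons0.
Qed.

Lemma update_vcons k u (v : 'I_k -> V) x :
  vcons x v = [eta vcons u v with ord0 |-> x].
Proof.
apply/funext => j; case: (unliftP ord0 j) => [m|] ->; rewrite ?vconsS ?vcons0 //=.
by rewrite vconsS.
Qed.

Lemma multilinear_interior k u (a : kform V k.+1) :
  multilinear a -> multilinear (u ⌟ a).
Proof. by move=> ma v i c x y; rewrite !interiorE !vcons_update ma. Qed.

Lemma vcons_lin k (a : kform V k.+1) (v : 'I_k -> V) c x y : multilinear a ->
  a (vcons (c *: x + y) v) = c * (a (vcons x v) : R) + a (vcons y v).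
Proof.
move=> ma; rewrite (update_vcons 0 v) (update_vcons 0 v x) (update_vcons 0 v y).
by rewrite ma.
Qed.

Lemma vcons_lincomb k (a : kform V k.+1) (v : 'I_k -> V) n (c : 'I_n -> R)
    (x : 'I_n -> V) : multilinear a ->
  a (vcons (\sum_i c i *: x i) v) = \sum_i c i * (a (vcons (x i) v) : R).
Proof.
move=> ma; elim/big_rec2: _ => [|i y z _ <-]; last by rewrite vcons_lin.
have := vcons_lin v 1 0 0 ma; rewrite scaler0 addr0 mul1r => /eqP.
by rewrite -subr_eq0 opprD addrA subrr sub0r oppr_eq0 => /eqP.
Qed.

Lemma big_ffun_cons k n (F : ('I_k.+1 -> 'I_n) -> R) :
  \sum_(T : {ffun 'I_k.+1 -> 'I_n}) F T =
  \sum_i \sum_(T : {ffun 'I_k -> 'I_n}) F (vcons i T).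
Proof.
rewrite pair_big /=.
rewrite (reindex (fun p : 'I_n * {ffun 'I_k -> 'I_n} => finfun (vcons p.1 p.2))).
  by apply: eq_bigr => p _; congr F; apply/funext => i; rewrite ffunE.
exists (fun T : {ffun 'I_k.+1 -> 'I_n} => (T ord0, [ffun i => T (lift ord0 i)])).
  move=> [i T] _ /=; congr pair; first by rewrite ffunE vcons0.
  by apply/ffunP => j; rewrite !ffunE vconsS.
move=> T _; apply/ffunP => j; rewrite ffunE [in RHS](vcons_eta T) /=.
by congr (vcons _ _ _); apply/funext => m; rewrite ffunE.
Qed.

Lemma big_ffun0 n (F : ('I_0 -> 'I_n) -> R) (w : 'I_0 -> 'I_n) :
  \sum_(T : {ffun 'I_0 -> 'I_n}) F T = F w.
Proof.
rewrite (big_pred1 (finfun w)) => [|T]; first by congr F; apply/funext => -[].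
by rewrite /=; apply/esym/eqP/ffunP => -[].
Qed.

(** Induction on the number of slots: slot 0 is expanded first, and the interior product with
    each x_i is again multilinear. *)
Lemma multilinear_expand k n (a : kform V k) (c : 'I_k -> 'I_n -> R)
    (x : 'I_n -> V) : multilinear a ->
  a (fun r => \sum_i c r i *: x i) =
  \sum_(T : {ffun 'I_k -> 'I_n}) \prod_r c r (T r) * (a (fun r => x (T r)) : R).
Proof.
elim: k a c => [|k IHk] a c ma.
  rewrite (big_ffun0 (fun T => \prod_r c r (T r) * (a (fun r => x (T r)) : R))
    (fun i => ffun0 (card_ord 0) i)).
  by rewrite big_ord0 mul1r; congr a; apply/funext => -[].
rewrite (big_ffun_cons (fun T => \prod_r c r (T r) * (a (fun r => x (T r)) : R))).
rewrite [X in a X]vcons_eta vcons_lincomb //; apply: eq_bigr => i _.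
rewrite -interiorE IHk; last exact: multilinear_interior.
rewrite mulr_sumr; apply: eq_bigr => T _; rewrite mulrA big_ord_recl vcons0.
congr (_ * _ * _); first by apply: eq_bigr => j _; rewrite vconsS.
rewrite interiorE; congr a; apply/funext => j.
by case: (unliftP ord0 j) => [m|] ->; rewrite ?vconsS ?vcons0.
Qed.

(** Expand a(.., v_i + v_j, .., v_i + v_j, ..) = 0. *)
Lemma alternating_tperm k (a : kform V k) (v : 'I_k -> V) i j :
  is_alternating a -> i != j -> a (fun r => v (tperm i j r)) = - (a v : R).
Proof.
move=> [ma aa] ij.
(* v with its entries i and j replaced by x and y. *)
pose w x y : 'I_k -> V := [eta [eta v with i |-> x] with j |-> y].
have w0 x : a (w x x) = 0.
  by apply: (aa _ i j ij); rewrite /w /= !eqxx (negbTE ij).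
have wC x y : w x y = [eta [eta v with j |-> y] with i |-> x].
  apply/funext => r; rewrite /w /=.
  by case: (eqVneq r j) => [->|//]; rewrite eq_sym (negbTE ij).
have wDr x y z : a (w x (y + z)) = a (w x y) + a (w x z).
  by have := ma [eta v with i |-> x] j 1 y z; rewrite scale1r mul1r.
have wDl x y z : a (w (y + z) x) = a (w y x) + a (w z x).
  by rewrite !wC; have := ma [eta v with j |-> x] i 1 y z; rewrite scale1r mul1r.
have /eqP := w0 (v i + v j); rewrite wDr !wDl !w0 addr0 add0r addr_eq0 => /eqP h.
have vE : v = w (v i) (v j).
  apply/funext => r; rewrite /w /=.
  by case: eqVneq => [->//|_]; case: eqVneq => [->//|_].
rewrite [X in _ = - a X]vE -h; congr a; apply/funext => r; rewrite /w /=.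
case: tpermP => [->|->|/eqP/negbTE ri /eqP/negbTE rj].
- by rewrite ?eqxx ?(negbTE ij) ?eqxx.
- by rewrite ?eqxx ?(negbTE ij) ?eqxx.
- by rewrite ri rj.
Qed.

Lemma alternating_perm k (a : kform V k) (v : 'I_k -> V) (s : 'S_k) :
  is_alternating a -> a (fun r => v (s r)) = (-1) ^+ s * (a v : R).
Proof.
move=> alta; have [ts -> dts] := prod_tpermP s.
elim: ts dts => [|t ts IHts] /= => [_|/andP[dt /IHts IH]].
  rewrite big_nil odd_perm1 mul1r; congr a; apply/funext => r.
  by rewrite perm1.
rewrite big_cons odd_permM signr_addb odd_tperm dt expr1 mulN1r.
pose v' r := v ((\prod_(i <- ts) tperm i.1 i.2)%g r).
have -> : (fun r => v ((tperm t.1 t.2 * \prod_(j <- ts) tperm j.1 j.2)%g r)) =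
          (fun r => v' (tperm t.1 t.2 r)) by apply/funext => r; rewrite permM.
by rewrite alternating_tperm // IH mulNr.
Qed.

(** A top-degree form is determined by one value: in the multilinear expansion only injective
    index maps survive, and these are permutations, weighted by their signs. *)
Lemma alternating_top n (a : kform V n) (c : 'I_n -> 'I_n -> R) (x : 'I_n -> V) :
  is_alternating a ->
  a (fun r => \sum_i c r i *: x i) = \det (\matrix_(i, j) c i j) * (a x : R).
Proof.
move=> alta; rewrite multilinear_expand; last by case: alta.
rewrite (bigID (fun T : {ffun 'I_n -> 'I_n} => injectiveb T)) /= addrC big1 => [|T]; last first.
  move=> /injectivePn[i [j ij Tij]]; case: alta => _ aa.
  by rewrite (aa _ i j ij) ?mulr0 // Tij.
rewrite add0r (reindex (@pval _)) /=; last first.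
  pose in_Sn := insubd (1%g : 'S_n).
  by exists in_Sn => /= f Uf; first apply: val_inj; apply: insubdK.
rewrite mulr_suml; apply: eq_big => [s|s _]; first exact: (valP s).
rewrite -mulrA mulrCA -[X in _ = _ * X]alternating_perm //.
congr (_ * _); first by apply: eq_bigr => i _; rewrite mxE pvalE.
by congr a; apply/funext => r; rewrite pvalE.
Qed.

End Multilinear.

(** * The metric and the volume form in a standard frame *)

Section DotProduct.
Variables (R : realType) (V : vectType R) (g : {dot V for idfun}).

Lemma dotC u v : g u v = g v u.
Proof. by rewrite hermC expr0 mul1r. Qed.

Lemma dotDl u v w : g (u + v) w = g u w + g v w.
Proof. exact: linearDl. Qed.

Lemma dotZl c u w : g (c *: u) w = c * g u w.
Proof. exact: linearZl_LR. Qed.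

Lemma dotDr u v w : g w (u + v) = g w u + g w v.
Proof. exact: linearDr. Qed.

Lemma dotZr c u w : g w (c *: u) = c * g w u.
Proof. exact: linearZr_LR. Qed.

Lemma dotNl u w : g (- u) w = - g u w.
Proof. exact: linearNl. Qed.

Lemma dotNr u w : g w (- u) = - g w u.
Proof. exact: linearNr. Qed.

Lemma dot_sumr I (r : seq I) (P : pred I) F w :
  g w (\sum_(i <- r | P i) F i) = \sum_(i <- r | P i) g w (F i).
Proof. exact: linear_sumr. Qed.

Lemma dot_suml I (r : seq I) (P : pred I) F w :
  g (\sum_(i <- r | P i) F i) w = \sum_(i <- r | P i) g (F i) w.
Proof. exact: linear_sumlz. Qed.

Lemma dot_gt0 u : u != 0 -> 0 < g u u.
Proof. exact: neq0_dnorm_gt0. Qed.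

End DotProduct.

(** The normal form of a G2-structure, with the indices 1..7 shifted to 0..6. *)
Definition phi_std : combination :=
  [:: (1, [:: 0; 1; 2]%N); (-1, [:: 0; 3; 4]%N); (-1, [:: 0; 5; 6]%N);
      (-1, [:: 1; 3; 5]%N); (-1, [:: 1; 6; 4]%N);
      (-1, [:: 2; 3; 6]%N); (-1, [:: 2; 4; 5]%N)].

Section Frame.
Variables (R : realType) (V : vectType R).

(** Indexed by nat to match the index lists of monomials. Since the index i is not bounded
    in the first clause and E spans V, f i vanishes for 7 <= i. *)
Definition dual_frame (f : nat -> 'Hom(V, R^o)) (E : nat -> V) :=
  (forall i j, (j < 7)%N -> f i (E j) = (i == j)%:R) /\
  (forall v, v = \sum_(i < 7) f i v *: E i).

(** The map v |-> (e_i v)_i is injective because the e_i span the dual space, hence bijective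
    by dimension count; E_j is the preimage of the j-th unit vector. *)
Lemma exists_dual_frame (e : 7.-tuple 'Hom(V, R^o)) :
  \dim (fullv : {vspace V}) = 7%N ->
  basis_of (fullv : {vspace 'Hom(V, R^o)}) e ->
  exists E, dual_frame (fun i => e`_i) E.
Proof.
move=> dimV be.
pose T v : 'rV[R]_7 := \row_(i < 7) e`_i v.
have Tlin : linear T by move=> c u v; apply/rowP => i; rewrite !mxE linearP.
pose TH := linfun (HB.pack_for {linear V -> 'rV[R]_7} T
  (GRing.isLinear.Build R V 'rV[R]_7 _ T Tlin)).
have TE v : TH v = T v by rewrite lfunE.
have ker0 : lker TH == 0%VS.
  rewrite -subv0; apply/subvP => v; rewrite memv_ker TE memv0 => /eqP Tv.
  have h0 (h : 'Hom(V, R^o)) : h v = 0.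
    rewrite (coord_basis be (memvf h)) sum_lfunE big1 // => i _.
    rewrite scale_lfunE; have := congr1 (fun r : 'rV_7 => r 0 i) Tv.
    by rewrite !mxE => ->; rewrite scaler0.
  rewrite (coord_vbasis (memvf v)) big1 // => i _.
  have := h0 (linfun (coord (vbasis fullv) i : V -> R^o)).
  by rewrite lfunE /= => ->; rewrite scale0r.
have img : limg TH = fullv.
  apply/eqP; rewrite eqEdim subvf /= dimvf dim_matrix.
  by have := limg_ker_dim TH fullv; rewrite (eqP ker0) capv0 dimv0 add0n => ->; rewrite dimV.
pose E j := if insub j is Some i then (TH^-1)%VF (delta_mx 0 (i : 'I_7)) else 0.
have fE i j : (j < 7)%N -> e`_i (E j) = (i == j)%:R.
  move=> j7; rewrite /E insubT; set d := delta_mx _ _.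
  have Td : T ((TH^-1)%VF d) = d by rewrite -TE limg_lfunVK // img memvf.
  case: (ltnP i 7) => i7.
    have := congr1 (fun r : 'rV_7 => r 0 (Ordinal i7)) Td.
    by rewrite !mxE /= => ->.
  rewrite nth_default ?size_tuple // lfunE /=.
  by case: eqP i7 => // ->; rewrite leqNgt j7.
exists E; split=> // v; move/lker0P: ker0 => injT; apply: injT.
rewrite !TE; apply/rowP => i; rewrite !mxE linear_sum /= (bigD1 i) //= linearZ /=.
rewrite fE // eqxx big1 => [|j ji]; first by rewrite addr0 [RHS]mulr1.
by rewrite linearZ /= fE // eq_sym (negbTE ji : (j == i :> nat) = false) scaler0.
Qed.

Lemma G2_standard_frame (phi : kform V 3) :
  \dim (fullv : {vspace V}) = 7%N -> linear_G2_structure phi ->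
  exists f E, dual_frame f E /\ phi = denote f 3 phi_std.
Proof.
move=> dimV [e be] /= phiE; have [E fE] := exists_dual_frame dimV be.
exists (fun i => e`_i), E; split=> //; rewrite phiE.
rewrite !(covector_monomial (fun i => e`_i)) !wedgeDr !monomial_wedge // /denote.
rewrite !big_cons big_nil /= !scaleN1r scale1r.
by rewrite addr0 !opprD !addrA.
Qed.

Variables (f : nat -> 'Hom(V, R^o)) (E : nat -> V).
Hypothesis fE : dual_frame f E.

Lemma frame_dual i j : (j < 7)%N -> f i (E j) = (i == j)%:R.
Proof. by case: fE => h _; exact: h. Qed.

Lemma frame_sum v : v = \sum_(i < 7) f i v *: E i.
Proof. by case: fE. Qed.

Lemma frame_interior k i p : (i < 7)%N -> homogeneous k.+1 p ->
  E i ⌟ denote f k.+1 p = denote f k (comb_interior i p).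
Proof. by move=> i7; apply: denote_interior => j; rewrite frame_dual. Qed.

Lemma monomial_top_frame : monomial f 7 (iota 0 7) (fun i : 'I_7 => E i) = 1 :> R.
Proof.
rewrite /monomial -[RHS](det1 R 7); congr (\det _); apply/matrixP => i j.
by rewrite !mxE frame_dual // nth_iota // add0n.
Qed.

Lemma top_form (a : kform V 7) : is_alternating a ->
  a = (a (fun i : 'I_7 => E i) : R) *: monomial f 7 (iota 0 7).
Proof.
move=> alta; apply: kform_ext => v; rewrite kformZE mulrC.
have -> : v = (fun r => \sum_(i < 7) f i (v r) *: E i).
  by apply/funext => r; rewrite -frame_sum.
rewrite alternating_top //; congr (_ * _); rewrite /monomial -det_tr.
congr (\det _); apply/matrixP => i j; rewrite !mxE nth_iota // add0n.
by rewrite -frame_sum.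
Qed.

(** The symmetric form of phi is Euclidean in a standard frame, and the volume form it singles
    out is positive on the frame. The 49 entries are evaluated. *)
Lemma phi_std_bilinear i j : (i < 7)%N -> (j < 7)%N ->
  (E i ⌟ denote f 3 phi_std) ∧ (E j ⌟ denote f 3 phi_std) ∧ denote f 3 phi_std =
  (6 * (i == j)%:R : R) *: monomial f 7 (iota 0 7).
Proof.
move=> i7 j7; rewrite !frame_interior //.
pose a := comb_interior i phi_std; pose b := comb_interior j phi_std.
pose c : combination := [:: (6 * (i == j)%:R, iota 0 7)].
have /and5P[ha hb hab habp habc] : [&& homogeneous 2 a, homogeneous 2 b,
    homogeneous 4 (comb_wedge a b),
    homogeneous 7 (comb_wedge (comb_wedge a b) phi_std) &
    comb_eq (comb_wedge (comb_wedge a b) phi_std) c].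
  rewrite /a /b /c; move: i j i7 j7 {a b c}.
  suff /allP h : all (fun i => all (fun j => let a := comb_interior i phi_std in
    let b := comb_interior j phi_std in
    [&& homogeneous 2 a, homogeneous 2 b, homogeneous 4 (comb_wedge a b),
      homogeneous 7 (comb_wedge (comb_wedge a b) phi_std) &
      comb_eq (comb_wedge (comb_wedge a b) phi_std)
        [:: (6 * (i == j)%:R, iota 0 7)]]) (iota 0 7)) (iota 0 7).
    move=> i j i7 j7; have /h /allP hi : i \in iota 0 7 by rewrite mem_iota.
    by apply: hi; rewrite mem_iota.
  by vm_compute.
rewrite !denote_wedge // (denote_eq f (q := c)) //.
by rewrite /denote big_seq1 /= rmorphM /= !rmorph_nat.
Qed.

Lemma scaled_orthonormal (g : {dot V for idfun}) (lambda s : R) :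
  (forall i j, (i < 7)%N -> (j < 7)%N -> g (E i) (E j) = lambda * (i == j)%:R) ->
  s * s * lambda = 1 ->
  orthonormal g [tuple s *: E i | i < 7].
Proof.
move=> gE sl.
have gs i j : (i < 7)%N -> (j < 7)%N -> g (s *: E i) (s *: E j) = (i == j)%:R.
  by move=> i7 j7; rewrite dotZl dotZr gE // !mulrA sl mul1r.
have -> : tval [tuple s *: E i | i < 7] = [seq s *: E i | i <- iota 0 7].
  by rewrite -[iota 0 7](val_enum_ord 7) -map_comp.
rewrite /orthonormal /= /ortho_rec /=.
by rewrite !gs //= !eqxx.
Qed.

(** The identity 6 g(u, v) vol = (u _| phi) ∧ (v _| phi) ∧ phi ties the scales of g and vol to
    each other: g is lambda times the Euclidean product, with lambda vol(E) = 1. The normalisation of vol on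
    orthonormal bases then says that c = 1 / lambda satisfies c^(9/2) = 1. *)
Lemma G2_metric_volume_frame (phi : kform V 3) (g : {dot V for idfun})
    (vol : kform V 7) :
  phi = denote f 3 phi_std -> G2_metric_volume phi g vol ->
  (forall i j, (i < 7)%N -> (j < 7)%N -> g (E i) (E j) = (i == j)%:R) /\
  vol = monomial f 7 (iota 0 7).
Proof.
move=> phiE [altvol vol1 gvol].
pose c : R := vol (fun i : 'I_7 => E i).
have gc i j : (i < 7)%N -> (j < 7)%N -> g (E i) (E j) * c = (i == j)%:R.
  move=> i7 j7; have := gvol (E i) (E j); rewrite phiE phi_std_bilinear //.
  move=> /(congr1 (fun a : kform V 7 => a (fun i : 'I_7 => E i) : R)).
  rewrite !kformZE monomial_top_frame mulr1 mulrA mulVf ?mul1r //.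
have c0 : c != 0.
  by apply/eqP => c0; have /eqP := gc 0%N 0%N isT isT; rewrite c0 mulr0 eq_sym oner_eq0.
pose lambda := c^-1.
(* g is lambda times the Euclidean product; s rescales E to an orthonormal frame. *)
have gl i j : (i < 7)%N -> (j < 7)%N -> g (E i) (E j) = lambda * (i == j)%:R.
  by move=> i7 j7; rewrite -(gc i j) // mulrCA mulVf // mulr1.
have l0 : 0 < lambda.
  have := gl 0%N 0%N isT isT; rewrite mulr1 => <-; apply: dot_gt0.
  apply/eqP => E0; have := frame_dual 0 (isT : 0 < 7)%N.
  by rewrite E0 linear0 => /eqP; rewrite eq_sym oner_eq0.
pose s := Num.sqrt c.
have cp : 0 < c by rewrite -invr_gt0.
have ss : s * s = c by rewrite -expr2 sqr_sqrtr // ltW.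
have s0 : 0 < s by rewrite sqrtr_gt0.
have := vol1 _ (scaled_orthonormal gl _ : orthonormal g [tuple s *: E i | i < 7]).
rewrite ss mulfV // => /(_ erefl).
have -> : tnth [tuple s *: E i | i < 7] =
    (fun r : 'I_7 => \sum_(i < 7) (s * (r == i)%:R) *: E i).
  apply/funext => r; rewrite tnth_mktuple (bigD1 r) //= eqxx mulr1.
  rewrite big1 ?addr0 // => i ir.
  by rewrite eq_sym (negbTE ir) mulr0 scale0r.
rewrite alternating_top // (_ : \matrix_(i, j) _ = s%:M); last first.
  by apply/matrixP => i j; rewrite !mxE mulr_natr.
rewrite det_scalar -/c -ss -expr2 -exprD normrX gtr0_norm // => /eqP.
rewrite pexpr_eq1 ?ltW // => /eqP s1.
have c1 : c = 1 by rewrite -ss s1 mulr1.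
split=> [i j i7 j7|]; first by rewrite gl // /lambda c1 invr1 mul1r.
by rewrite (top_form altvol) -/c c1 scale1r.
Qed.

End Frame.

(** * Cross products and the frame adapted to an isotropic triple *)

(** The G2 cross product, abstractly. [XX] is the polarisation of
    u x (u x v) = - |u|^2 v + <u, v> u. *)
Section CrossProduct.
Variables (R : realType) (V : vectType R) (g : {dot V for idfun}).
Variable X : V -> V -> V.
Hypothesis XP : forall c u v w, X (c *: u + v) w = c *: X u w + X v w.
Hypothesis XC : forall u v, X u v = - X v u.
Hypothesis X_cyc : forall u v w, g (X u v) w = g (X v w) u.
Hypothesis XX : forall u v w, X u (X w v) + X w (X u v) =
  (- 2 * g u w) *: v + g u v *: w + g w v *: u.

Lemma cross_addl u v w : X (u + v) w = X u w + X v w.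
Proof. by have := XP 1 u v w; rewrite !scale1r. Qed.

Lemma cross0l w : X 0 w = 0.
Proof.
by have /eqP := cross_addl 0 0 w; rewrite addr0 -subr_eq0 opprD addrA subrr sub0r oppr_eq0 => /eqP.
Qed.

Lemma cross_scalel c u w : X (c *: u) w = c *: X u w.
Proof. by have := XP c u 0 w; rewrite !addr0 cross0l addr0. Qed.

Lemma cross_oppl u w : X (- u) w = - X u w.
Proof. by rewrite -scaleN1r cross_scalel scaleN1r. Qed.

Lemma cross_addr u v w : X w (u + v) = X w u + X w v.
Proof. by rewrite XC cross_addl opprD -!XC. Qed.

Lemma cross_scaler c u w : X w (c *: u) = c *: X w u.
Proof. by rewrite XC cross_scalel -scalerN -XC. Qed.

Lemma cross_oppr u w : X w (- u) = - X w u.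
Proof. by rewrite -scaleN1r cross_scaler scaleN1r. Qed.

Lemma cross_self u : X u u = 0.
Proof.
have /eqP := XC u u; rewrite -subr_eq0 opprK -mulr2n => /eqP h.
by rewrite -[LHS](scalerK (_ : 2%:R != 0 :> R)) ?pnatr_eq0 // scaler_nat h scaler0.
Qed.

Lemma double_cross u v : X u (X u v) = - g u u *: v + g u v *: u.
Proof.
have h := XX u v u.
apply: (@scalerI _ _ (2%:R : R)); first by rewrite pnatr_eq0.
rewrite scaler_nat mulr2n h scalerDr !scalerA -addrA -scalerDl.
by congr (_ *: _ + _ *: _); ring.
Qed.

Lemma dot_cross_l u v : g (X u v) u = 0.
Proof. by rewrite X_cyc X_cyc cross_self -(scale0r 0) dotZl mul0r. Qed.

Lemma dot_cross_r u v : g (X u v) v = 0.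
Proof. by rewrite XC dotNl dot_cross_l oppr0. Qed.

(** An oriented line of the Fano plane: the products along it are cyclic, up to one sign s. *)
Definition cross_line (s : R) u v w :=
  [/\ X u v = s *: w, X v w = s *: u & X w u = s *: v].

(** For orthonormal u and v the double product identity recovers the other two products from
    u x v. *)
Lemma cross_lineP s u v w : s ^+ 2 = 1 -> g u u = 1 -> g v v = 1 -> g u v = 0 ->
  X u v = s *: w -> cross_line s u v w.
Proof.
move=> s2 uu vv uv uvw.
have wE : w = s *: X u v by rewrite uvw scalerA -expr2 s2 scale1r.
split=> //; rewrite wE.
  by rewrite cross_scaler [X u v]XC cross_oppr double_cross vv dotC uv scale0r addr0 scaleN1r opprK.
by rewrite cross_scalel XC double_cross uu uv scale0r addr0 scaleN1r opprK.
Qed.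

Lemma cross_line_orth s u v w : s ^+ 2 = 1 -> cross_line s u v w ->
  [/\ g u v = 0, g v w = 0 & g w u = 0].
Proof.
move=> s2 [uvw vwu wuv].
have E (a b : V) : s *: a = b -> a = s *: b by move=> <-; rewrite scalerA -expr2 s2 scale1r.
split.
- by rewrite (E u (X v w)) // dotZl dot_cross_l mulr0.
- by rewrite (E v (X w u)) // dotZl dot_cross_l mulr0.
- by rewrite (E w (X u v)) // dotZl dot_cross_l mulr0.
Qed.

Lemma cross_line_norm s u v w : s ^+ 2 = 1 -> g u u = 1 -> cross_line s u v w ->
  g v v = 1 -> g w w = 1.
Proof.
move=> s2 uu [uvw vwu wuv] vv.
have wE : w = s *: X u v by rewrite uvw scalerA -expr2 s2 scale1r.
by rewrite {1}wE dotZl X_cyc vwu dotZl uu mulr1 -expr2.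
Qed.

Variables x y z : V.
Hypotheses (xx : g x x = 1) (yy : g y y = 1) (zz : g z z = 1).
Hypotheses (xy : g x y = 0) (yz : g y z = 0) (zx : g z x = 0).
Hypothesis xyz : g (X x y) z = 0.

(** With x, y, z in the places of e_4, e_5, e_6, the table of [phi_std] forces the rest:
    e_5 x e_6 = - e_0, e_6 x e_4 = - e_1, e_4 x e_5 = - e_2 and e_4 x e_0 = - e_3. *)
Definition completed_triple : seq V :=
  [:: - X y z; - X z x; - X x y; X x (X y z); x; y; z].
Local Notation E i := (nth 0 completed_triple i).

Local Notation E0 := (- X y z).
Local Notation E1 := (- X z x).
Local Notation E2 := (- X x y).
Local Notation E3 := (X x (X y z)).
Local Notation E4 := x.
Local Notation E5 := y.
Local Notation E6 := z.

Let s1 : (1 : R) ^+ 2 = 1. Proof. by rewrite expr1n. Qed.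
Let sN1 : (- 1 : R) ^+ 2 = 1. Proof. by rewrite sqrrN expr1n. Qed.

Let l560 : cross_line (-1) E5 E6 E0.
Proof. by apply: cross_lineP => //; rewrite scaleN1r opprK. Qed.
Let l641 : cross_line (-1) E6 E4 E1.
Proof. by apply: cross_lineP => //; rewrite scaleN1r opprK. Qed.
Let l452 : cross_line (-1) E4 E5 E2.
Proof. by apply: cross_lineP => //; rewrite scaleN1r opprK. Qed.

Let n0 : g E0 E0 = 1. Proof. exact: (cross_line_norm sN1 _ l560). Qed.
Let n1 : g E1 E1 = 1. Proof. exact: (cross_line_norm sN1 _ l641). Qed.
Let n2 : g E2 E2 = 1. Proof. exact: (cross_line_norm sN1 _ l452). Qed.

Let o40 : g E4 E0 = 0.
Proof. by rewrite dotC dotNl -X_cyc xyz oppr0. Qed.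
Let o51 : g E5 E1 = 0.
Proof. by rewrite dotC dotNl X_cyc xyz oppr0. Qed.
Let o62 : g E6 E2 = 0.
Proof. by rewrite dotC dotNl xyz oppr0. Qed.

Let Xyzx : X y (X z x) = X x (X y z).
Proof.
have /eqP := XX x z y; rewrite xy yz [g x z]dotC zx mulr0 !scale0r !addr0 addrC addr_eq0 => /eqP.
by rewrite [X x z]XC cross_oppr => /oppr_inj.
Qed.

Let Xzxy : X z (X x y) = X x (X y z).
Proof.
have /eqP := XX x y z; rewrite xy [g x z]dotC zx [g z y]dotC yz.
rewrite mulr0 !scale0r !addr0 addrC addr_eq0 => /eqP ->.
by rewrite [X z y]XC cross_oppr opprK.
Qed.

Let l403 : cross_line (-1) E4 E0 E3.
Proof. by apply: cross_lineP => //; rewrite cross_oppr scaleN1r. Qed.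
Let l513 : cross_line (-1) E5 E1 E3.
Proof. by apply: cross_lineP => //; rewrite cross_oppr scaleN1r Xyzx. Qed.
Let l623 : cross_line (-1) E6 E2 E3.
Proof. by apply: cross_lineP => //; rewrite cross_oppr scaleN1r Xzxy. Qed.

Let n3 : g E3 E3 = 1. Proof. exact: (cross_line_norm sN1 _ l403). Qed.

Let l012 : cross_line 1 E0 E1 E2.
Proof.
have o01 : g E0 E1 = 0.
  rewrite dotNl dotNr opprK X_cyc double_cross dotDl !dotZl xy zx.
  by rewrite !(mulr0, mul0r, addr0).
apply: cross_lineP => //; rewrite scale1r.
have <- : X E6 E3 = E2.
  by rewrite [LHS]XC; case: l623 => _ _ ->; rewrite scaleN1r opprK.
rewrite cross_oppl cross_oppr opprK.
have /eqP := XX (X y z) x z; rewrite dot_cross_r zx mulr0 X_cyc X_cyc xyz.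
rewrite !scale0r !addr0 addr_eq0 => /eqP ->.
by rewrite [X (X y z) x]XC cross_oppr opprK.
Qed.

Lemma completed_triple_lines :
  [/\ cross_line 1 (E 0) (E 1) (E 2), cross_line (-1) (E 4) (E 0) (E 3),
      cross_line (-1) (E 5) (E 6) (E 0), cross_line (-1) (E 5) (E 1) (E 3) &
   [/\ cross_line (-1) (E 6) (E 4) (E 1), cross_line (-1) (E 6) (E 2) (E 3) &
      cross_line (-1) (E 4) (E 5) (E 2)]].
Proof. by []. Qed.

(** Any two of the seven points lie on one of the seven lines, and points of a line are
    orthogonal. *)
Lemma completed_triple_orthonormal i j : (i < 7)%N -> (j < 7)%N ->
  g (E i) (E j) = (i == j)%:R.
Proof.
have [a b c] := cross_line_orth s1 l012; have [a1 b1 c1] := cross_line_orth sN1 l560.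
have [a2 b2 c2] := cross_line_orth sN1 l641; have [a3 b3 c3] := cross_line_orth sN1 l452.
have [a4 b4 c4] := cross_line_orth sN1 l403; have [a5 b5 c5] := cross_line_orth sN1 l513.
have [a6 b6 c6] := cross_line_orth sN1 l623.
do 7! (case: i => [|i]; first (do 7! (case: j => [|j]; first
  (by move=> _ _; rewrite /= ?mulr1n ?mulr0n;
    first [assumption | rewrite dotC; assumption])); by [])); by [].
Qed.

End CrossProduct.

Section StandardCross.
Variables (R : realType) (V : vectType R) (g : {dot V for idfun}).
Variables (f : nat -> 'Hom(V, R^o)) (E : nat -> V).
Hypothesis fE : dual_frame f E.
Hypothesis gE : forall i j, (i < 7)%N -> (j < 7)%N -> g (E i) (E j) = (i == j)%:R.

Lemma frame_ext u v : (forall k, (k < 7)%N -> f k u = f k v) -> u = v.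
Proof.
move=> uv; rewrite (frame_sum fE u) (frame_sum fE v).
by apply: eq_bigr => i _; rewrite uv.
Qed.

Lemma frame_coord (c : nat -> R) k : (k < 7)%N ->
  f k (\sum_(i < 7) c i *: E i) = c k.
Proof.
move=> k7; rewrite linear_sum (bigD1 (Ordinal k7)) //= linearZ /= (frame_dual fE) //.
rewrite eqxx big1 => [|j jk]; first by rewrite addr0 [LHS]mulr1.
by rewrite linearZ /= (frame_dual fE) // eq_sym (negbTE jk : (j == k :> nat) = false) scaler0.
Qed.

Lemma frame_dot u v : g u v = \sum_(i < 7) f i u * f i v.
Proof.
rewrite {1}(frame_sum fE u) dot_suml; apply: eq_bigr => i _.
rewrite dotZl {1}(frame_sum fE v) dot_sumr (bigD1 i) //= dotZr gE // eqxx mulr1.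
rewrite big1 ?addr0 // => j ji.
by rewrite dotZr gE // eq_sym (negbTE ji : (j == i :> nat) = false) mulr0.
Qed.

(** The coordinate k of u x v, read off from phi_std: each of its terms s e^(ijk) contributes
    s (a_i b_j - a_j b_i) to coordinate k, and cyclically. *)
Definition cross_coord (a b : nat -> R) (k : nat) : R :=
  let w i j := a i * b j - a j * b i in
  match k with
  | 0%N => w 1%N 2%N - w 3%N 4%N - w 5%N 6%N
  | 1%N => w 2%N 0%N - w 3%N 5%N - w 6%N 4%N
  | 2%N => w 0%N 1%N - w 3%N 6%N - w 4%N 5%N
  | 3%N => - w 4%N 0%N - w 5%N 1%N - w 6%N 2%N
  | 4%N => - w 0%N 3%N - w 1%N 6%N - w 5%N 2%N
  | 5%N => - w 6%N 0%N - w 1%N 3%N - w 2%N 4%N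
  | 6%N => - w 0%N 5%N - w 4%N 1%N - w 2%N 3%N
  | _ => 0
  end.

Definition std_cross (u v : V) : V :=
  \sum_(k < 7) cross_coord (fun i => f i u) (fun i => f i v) k *: E k.

Lemma std_crossE u v k : (k < 7)%N ->
  f k (std_cross u v) = cross_coord (fun i => f i u) (fun i => f i v) k.
Proof. exact: frame_coord. Qed.

Lemma lfun_lin (h : 'Hom(V, R^o)) c u v : h (c *: u + v) = c * h u + h v :> R.
Proof. by rewrite linearP. Qed.

Lemma std_crossP c u v w :
  std_cross (c *: u + v) w = c *: std_cross u w + std_cross v w.
Proof.
apply: frame_ext => k k7; rewrite lfun_lin !std_crossE //.
do 7! (case: k k7 => [|k] k7; first by rewrite /= !lfun_lin; ring).
by [].
Qed.

Lemma std_crossC u v : std_cross u v = - std_cross v u.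
Proof.
apply: frame_ext => k k7; rewrite -scaleN1r -[-1 *: _]addr0 lfun_lin linear0 !std_crossE //.
do 7! (case: k k7 => [|k] k7; first by rewrite /=; ring).
by [].
Qed.

Lemma std_cross_cyc u v w : g (std_cross u v) w = g (std_cross v w) u.
Proof.
rewrite !frame_dot !big_ord_recl !big_ord0 /= !std_crossE //=.
by rewrite /bump /=; ring.
Qed.

Lemma std_cross_cross u v w :
  std_cross u (std_cross w v) + std_cross w (std_cross u v) =
  (- 2 * g u w) *: v + g u v *: w + g w v *: u.
Proof.
apply: frame_ext => k k7.
rewrite -[X in X + _]scale1r -addrA !lfun_lin linearZ /= !frame_dot.
rewrite !big_ord_recl !big_ord0 /bump /= !std_crossE //.
do 7! (case: k k7 => [|k] k7; first by
  rewrite /= !std_crossE //= [X in _ = _ + (_ + X)]/GRing.scale /=; ring).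
by [].
Qed.

Lemma phi_std_cross v :
  denote f 3 phi_std v = g (std_cross (v 0) (v 1)) (v 2%:R) :> R.
Proof.
rewrite frame_dot !big_ord_recl big_ord0 /bump /= !std_crossE //=.
rewrite /denote !big_cons big_nil !(kformDE, kformZE) /= !monomial3E.
by rewrite kform0E; ring.
Qed.

End StandardCross.

Section AdaptedFrame.
Variables (R : realType) (V : vectType R) (g : {dot V for idfun}).

Definition dot_covector (u : V) : 'Hom(V, R^o) := linfun (g u : V -> R^o).

Lemma dot_covectorE u v : dot_covector u v = g u v.
Proof.
have glin : linear (g u : V -> R^o) by move=> c a b; rewrite dotDr dotZr.
exact: (lfunE (HB.pack_for {linear V -> R^o} (g u : V -> R^o)
  (GRing.isLinear.Build R V R^o _ (g u : V -> R^o) glin)) v).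
Qed.

Variables (f : nat -> 'Hom(V, R^o)) (E : nat -> V).
Hypothesis fE : dual_frame f E.
Hypothesis gE : forall i j, (i < 7)%N -> (j < 7)%N -> g (E i) (E j) = (i == j)%:R.

(** The matrix M of E' in the frame E satisfies M M^T = 1, hence M^T M = 1, which is the
    expansion of every v in E'. *)
Lemma orthonormal_frame (E' : nat -> V) :
  (forall i j, (i < 7)%N -> (j < 7)%N -> g (E' i) (E' j) = (i == j)%:R) ->
  (forall i, (7 <= i)%N -> E' i = 0) ->
  dual_frame (fun i => dot_covector (E' i)) E'.
Proof.
move=> gE' E'0; split=> [i j j7|v].
  rewrite dot_covectorE; case: (ltnP i 7) => i7; first exact: gE'.
  rewrite E'0 // -(scale0r 0) dotZl mul0r.
  by case: eqP i7 => // ->; rewrite leqNgt j7.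
pose M : 'M[R]_7 := \matrix_(i, j) f j (E' i).
have MMt : M *m M^T = 1%:M.
  apply/matrixP => i j; rewrite !mxE -(gE' i j) // (frame_dot fE gE).
  by apply: eq_bigr => k _; rewrite !mxE.
have MtM : M^T *m M = 1%:M by apply: mulmx1C.
apply: (frame_ext fE) => k k7.
transitivity (\sum_(i < 7) \sum_(j < 7) f j v * (M i j * M i (Ordinal k7))); last first.
  rewrite linear_sum; apply: eq_bigr => i _ /=.
  rewrite linearZ /= dot_covectorE (frame_dot fE gE) [RHS]mulr_suml.
  by apply: eq_bigr => j _; rewrite !mxE /= mulrA [f j v * _]mulrC.
rewrite exchange_big /=.
rewrite (eq_bigr (fun j : 'I_7 => f j v * (j == Ordinal k7)%:R)); last first.
  move=> j _; rewrite -mulr_sumr; congr (_ * _).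
  have := congr1 (fun m : 'M[R]_7 => m j (Ordinal k7)) MtM; rewrite !mxE => <-.
  by apply: eq_bigr => i _; rewrite !mxE.
rewrite (bigD1 (Ordinal k7)) //= eqxx mulr1 big1 ?addr0 // => j jk.
by rewrite (negbTE jk) mulr0.
Qed.

(** Transitivity of G2 on orthonormal triples with phi(x, y, z) = 0. Such a triple completes to
    an orthonormal frame whose multiplication table is that of phi_std; phi and phi_std in the
    new frame are both <u x v, w>, for cross products that agree on the frame. *)
Lemma adapted_frame (phi : kform V 3) (x y z : V) :
  phi = denote f 3 phi_std ->
  g x x = 1 -> g y y = 1 -> g z z = 1 -> g x y = 0 -> g y z = 0 -> g z x = 0 ->
  phi (fun i => nth 0 [:: x; y; z] i) = 0 ->
  exists f' E', [/\ dual_frame f' E', phi = denote f' 3 phi_std &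
    [/\ E' 4 = x, E' 5 = y & E' 6 = z]%N].
Proof.
move=> phiE xx yy zz xy yz zx; rewrite phiE.
pose X := std_cross f E.
have phiX v : denote f 3 phi_std v = g (X (v 0) (v 1)) (v 2%:R) :> R.
  exact: (phi_std_cross fE gE).
have XP c u v w : X (c *: u + v) w = c *: X u w + X v w by exact: (std_crossP fE).
have XC u v : X u v = - X v u by exact: (std_crossC fE).
have Xcyc u v w : g (X u v) w = g (X v w) u by exact: (std_cross_cyc fE gE).
have XX u v w : X u (X w v) + X w (X u v) =
  (- 2 * g u w) *: v + g u v *: w + g w v *: u by exact: (std_cross_cross fE gE).
clearbody X; rewrite phiX /= => xyz.
have gE' := completed_triple_orthonormal XP XC Xcyc XX xx yy zz xy yz zx xyz.
have lines := completed_triple_lines XP XC Xcyc XX xx yy zz xy yz zx xyz.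
move: gE' lines; set E' := nth 0 _ => gE'.
case=> [[a0 b0 c0] [a1 b1 c1] [a2 b2 c2] [a3 b3 c3] [[a4 b4 c4] [a5 b5 c5] [a6 b6 c6]]].
have fE' : dual_frame (fun i => dot_covector (E' i)) E'.
  by apply: orthonormal_frame => // i i7; rewrite /E' nth_default.
exists (fun i => dot_covector (E' i)), E'; split=> //; clearbody E'.
apply: kform_ext => v; rewrite phiX (phi_std_cross fE' gE').
move: (v 0) (v 1) (v 2%:R) => u1 u2 u3.
have gXDl := (cross_addl XP); have gXZl := (cross_scalel XP).
have gXDr := (cross_addr XP XC); have gXZr := (cross_scaler XP XC); have XS := cross_self XC.
(* The 49 products of the frame vectors, one line at a time. *)
have gX00 p q i : g (X (p *: E' i) (q *: E' i)) u3 = 0.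
  by rewrite gXZl gXZr XS !scaler0 -(scale0r 0) dotZl mul0r.
have gXl i j m s : X (E' i) (E' j) = s *: E' m -> forall p q,
    g (X (p *: E' i) (q *: E' j)) u3 = p * q * s * g (E' m) u3.
  by move=> h p q; rewrite gXZl gXZr h !scalerA dotZl.
have gXr i j m s : X (E' i) (E' j) = s *: E' m -> forall p q,
    g (X (p *: E' j) (q *: E' i)) u3 = - (p * q * s * g (E' m) u3).
  by move=> h p q; rewrite [X _ _]XC dotNl (gXl _ _ _ _ h) [q * p]mulrC.
pose p i : R := dot_covector (E' i) u1; pose q i : R := dot_covector (E' i) u2.
have pE : u1 = \sum_(i < 7) p i *: E' i by exact: (frame_sum fE').
have qE : u2 = \sum_(i < 7) q i *: E' i by exact: (frame_sum fE').
have -> : std_cross (fun i => dot_covector (E' i)) E' u1 u2 =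
  \sum_(k < 7) cross_coord p q k *: E' k by [].
rewrite [in LHS]pE [in LHS]qE; clearbody p q.
rewrite dot_suml !big_ord_recl !big_ord0 /= /bump /= !add1n !addr0.
rewrite !(gXDl, gXDr) !dotDl !dotZl.
rewrite !gX00 !(gXl _ _ _ _ a0, gXl _ _ _ _ a1, gXl _ _ _ _ a2, gXl _ _ _ _ a3,
  gXl _ _ _ _ a4, gXl _ _ _ _ a5, gXl _ _ _ _ a6, gXl _ _ _ _ b0, gXl _ _ _ _ b1,
  gXl _ _ _ _ b2, gXl _ _ _ _ b3, gXl _ _ _ _ b4, gXl _ _ _ _ b5, gXl _ _ _ _ b6,
  gXl _ _ _ _ c0, gXl _ _ _ _ c1, gXl _ _ _ _ c2, gXl _ _ _ _ c3,
  gXl _ _ _ _ c4, gXl _ _ _ _ c5, gXl _ _ _ _ c6).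
rewrite !(gXr _ _ _ _ a0, gXr _ _ _ _ a1, gXr _ _ _ _ a2, gXr _ _ _ _ a3,
  gXr _ _ _ _ a4, gXr _ _ _ _ a5, gXr _ _ _ _ a6, gXr _ _ _ _ b0, gXr _ _ _ _ b1,
  gXr _ _ _ _ b2, gXr _ _ _ _ b3, gXr _ _ _ _ b4, gXr _ _ _ _ b5, gXr _ _ _ _ b6,
  gXr _ _ _ _ c0, gXr _ _ _ _ c1, gXr _ _ _ _ c2, gXr _ _ _ _ c3,
  gXr _ _ _ _ c4, gXr _ _ _ _ c5, gXr _ _ _ _ c6).
by ring.
Qed.

End AdaptedFrame.

(** * The Hodge star in an orthonormal frame *)

Section Hodge.
Variables (R : realType) (V : vectType R) (g : {dot V for idfun}).

Lemma multilinear_monomial (f : nat -> 'Hom(V, R^o)) k l :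
  multilinear (monomial f k l).
Proof.
move=> v i c x y.
have D v' : monomial f k l v' = \det (\matrix_(r, j) f (nth 0%N l j) (v' r)).
  by rewrite /monomial -det_tr; congr (\det _); apply/matrixP => r j; rewrite !mxE.
rewrite !D -[X in _ = _ + X]mul1r.
apply: (determinant_multilinear (i0 := i)).
- by apply/rowP => j; rewrite !mxE /= eqxx lfun_lin mul1r.
- by apply/matrixP => a b; rewrite !mxE /= eq_sym (negbTE (neq_lift _ _)).
- by apply/matrixP => a b; rewrite !mxE /= eq_sym (negbTE (neq_lift _ _)).
Qed.

Lemma multilinear_denote (f : nat -> 'Hom(V, R^o)) k p :
  multilinear (denote f k p).
Proof.
move=> v i c x y; rewrite /denote !kform_sumE mulr_sumr -big_split /=.
by apply: eq_bigr => t _; rewrite !kformZE multilinear_monomial; ring.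
Qed.

(** The arguments z followed by w, as the Hodge star feeds them to the volume form. *)
Definition vjoin T k l (z : 'I_k -> T) (w : 'I_l -> T) : 'I_(k + l) -> T :=
  fun s => match fintype.split s with inl r => z r | inr t => w t end.

Lemma multilinear_vjoin k l (a : kform V (k + l)) (w : 'I_l -> V) :
  multilinear a -> multilinear ((fun z => a (vjoin z w)) : kform V k).
Proof.
move=> ma v i c x y.
have E t : vjoin [eta v with i |-> t] w = [eta vjoin v w with lshift l i |-> t].
  apply/funext => s; rewrite /vjoin /=.
  case: splitP => [r|r] rs /=; last first.
    by case: eqP => // si; move: rs (ltn_ord i); rewrite si /= => ->; rewrite ltnNge leq_addr.
  by rewrite -!(inj_eq val_inj) /= rs.
by rewrite !E ma.
Qed.

(** Writing E = C x for the basis x that defines the star, the inverse Gram matrix of x is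
    C^T C. Moving each factor C into a slot of a or of vol turns the basis vectors into E. *)
Lemma hodge_star_orthonormal m (E : 'I_m -> V) k l (vol : kform V (k + l))
    (a : kform V k) (w : 'I_l -> V) :
  multilinear a -> multilinear vol ->
  (forall i j, g (E i) (E j) = (i == j)%:R) ->
  (forall v, v = \sum_i g v (E i) *: E i) ->
  hodge_star g vol a w = (k`!%:R)^-1 *
    \sum_(T : {ffun 'I_k -> 'I_m})
      (a (fun r => E (T r)) : R) * (vol (vjoin (fun r => E (T r)) w) : R) :> R.
Proof.
move=> ma mvol gE spanE; rewrite /hodge_star; congr (_ * _).
set n := \dim fullv; set x := tnth (vbasis fullv); set G := \matrix_(i, j) _.
pose C : 'M[R]_(m, n) := \matrix_(t, i) coord (vbasis fullv) i (E t).
pose S : 'M[R]_(n, m) := \matrix_(i, t) g (x i) (E t).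
have Ex t : E t = \sum_i C t i *: x i.
  rewrite {1}(coord_vbasis (memvf (E t))); apply: eq_bigr => i _.
  by rewrite mxE /x (tnth_nth 0).
have CS : C *m S = 1%:M.
  apply/matrixP => t s; rewrite !mxE -gE [in RHS]Ex dot_suml.
  by apply: eq_bigr => i _; rewrite !mxE dotZl.
have SC : S *m C = 1%:M.
  apply/matrixP => i j; rewrite !mxE.
  have fb : free (vbasis (fullv : {vspace V})) by apply: basis_free (vbasisP _).
  rewrite -(coord_free i j fb) -(tnth_nth 0) -/x [in RHS](spanE (x i)) linear_sum /=.
  by apply: eq_bigr => t _; rewrite linearZ /= !mxE.
have GE : G = S *m S^T.
  apply/matrixP => i j; rewrite !mxE [in LHS](spanE (x i)) dot_suml.
  by apply: eq_bigr => t _; rewrite dotZl !mxE [g (E t) _]dotC.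
have Ginv : invmx G = C^T *m C.
  have GC : G *m (C^T *m C) = 1%:M.
    by rewrite GE mulmxA -(mulmxA S) -trmx_mul CS trmx1 mulmx1 SC.
  have [Gu _] := mulmx1_unit GC.
  by rewrite -[RHS](mulKmx Gu) GC mulmx1.
transitivity (\sum_(I : {ffun 'I_k -> 'I_n}) \sum_(M : {ffun 'I_k -> 'I_n})
    \sum_(T : {ffun 'I_k -> 'I_m})
    ((\prod_r C (T r) (M r) * (a (fun r => x (M r)) : R)) *
     (\prod_r C (T r) (I r) * (vol (vjoin (fun r => x (I r)) w) : R)))).
  apply: eq_bigr => I _; apply: eq_bigr => M _.
  rewrite [X in X * _ * _](_ : _ = \sum_(T : {ffun 'I_k -> 'I_m})
      \prod_r C (T r) (M r) * \prod_r C (T r) (I r)); last first.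
    rewrite Ginv; under eq_bigr do rewrite mxE.
    rewrite bigA_distr_bigA; apply: eq_bigr => T _; rewrite -big_split /=.
    by apply: eq_bigr => r _; rewrite !mxE mulrC.
  rewrite !mulr_suml; apply: eq_bigr => T _; rewrite -/(vjoin _ w).
  by ring.
under eq_bigr do rewrite exchange_big.
rewrite exchange_big; apply: eq_bigr => T _ /=.
rewrite exchange_big /=.
have ET : (fun r => E (T r)) = (fun r => \sum_i C (T r) i *: x i).
  by apply/funext => r; rewrite -Ex.
rewrite ET multilinear_expand // mulr_suml; apply: eq_bigr => M _.
rewrite (multilinear_expand (a := (fun z => vol (vjoin z w)) : kform V k)); last first.
  exact: multilinear_vjoin.
by rewrite mulr_sumr.
Qed.

Lemma vjoin_vcons T k l u (z : 'I_k -> T) (w : 'I_l -> T) :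
  vjoin (vcons u z) w = vcons u (vjoin z w) :> ('I_(k + l).+1 -> T).
Proof.
apply/funext => s; rewrite /vjoin; case: (unliftP ord0 s) => [j|] ->.
  rewrite vconsS; case: splitP => r; rewrite lift0.
    case: (unliftP ord0 r) => [r'|] -> //; rewrite lift0 => -[jr].
    by rewrite vconsS; case: splitP => t; rewrite jr => rt;
      [congr z; apply/val_inj | move: (ltn_ord r'); rewrite rt ltnNge leq_addr].
  rewrite addSn => -[jr]; case: splitP => t; rewrite jr => rt.
    by move: (ltn_ord t); rewrite -rt ltnNge leq_addr.
  by congr w; apply/val_inj/eqP; rewrite -(eqn_add2l k) rt.
rewrite vcons0; case: splitP => r //= r0.
by rewrite (_ : r = ord0) ?vcons0 //; apply/val_inj.
Qed.

Lemma vjoin0 T l (z : 'I_0 -> T) (w : 'I_l -> T) : vjoin z w = w.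
Proof.
apply/funext => s; rewrite /vjoin; case: splitP => [[]//|t st].
by congr w; apply/val_inj.
Qed.

End Hodge.

(** The Hodge dual of [phi_std]; each term is the complementary monomial, signed. *)
Definition star_std : combination :=
  [:: (1, [:: 3; 4; 5; 6]%N);
      (-1, [:: 1; 2; 3; 4]%N); (-1, [:: 1; 2; 5; 6]%N);
      (-1, [:: 2; 0; 3; 5]%N); (-1, [:: 2; 0; 6; 4]%N);
      (-1, [:: 0; 1; 3; 6]%N); (-1, [:: 0; 1; 4; 5]%N)].

Definition contract3 (a b c : nat) (p : combination) : combination :=
  comb_interior c (comb_interior b (comb_interior a p)).

Definition phi_entry (a b c : nat) : int :=
  foldr (fun t s => t.1 + s) 0 (contract3 a b c phi_std).

(** The terms of 3! *phi, that is of the sum of phi(E_a, E_b, E_c) e^0123456(E_a, E_b, E_c, ..)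
    over all a, b, c. *)
Definition star_terms : combination :=
  flatten [seq flatten [seq flatten [seq
    if phi_entry a b c == 0 then [::]
    else comb_scale (phi_entry a b c) (contract3 a b c [:: (1, iota 0 7)])
    | c <- iota 0 7] | b <- iota 0 7] | a <- iota 0 7].

Section StandardStar.
Variables (R : realType) (V : vectType R) (g : {dot V for idfun}).
Variables (f : nat -> 'Hom(V, R^o)) (E : nat -> V).
Hypothesis fE : dual_frame f E.
Hypothesis gE : forall i j, (i < 7)%N -> (j < 7)%N -> g (E i) (E j) = (i == j)%:R.

Lemma frame_contract3 a b c k p : (a < 7)%N -> (b < 7)%N -> (c < 7)%N ->
  homogeneous k.+3 p -> homogeneous k.+2 (comb_interior a p) ->
  homogeneous k.+1 (comb_interior b (comb_interior a p)) ->
  E c ⌟ E b ⌟ E a ⌟ denote f k.+3 p = denote f k (contract3 a b c p).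
Proof. by move=> a7 b7 c7 h1 h2 h3; rewrite !(frame_interior fE). Qed.

Lemma phi_entryE a b c (w : 'I_0 -> V) : (a < 7)%N -> (b < 7)%N -> (c < 7)%N ->
  denote f 3 phi_std (vcons (E a) (vcons (E b) (vcons (E c) w))) =
  (phi_entry a b c)%:~R :> R.
Proof.
move=> a7 b7 c7; rewrite -!interiorE.
have /and3P[h1 h2 h3] : [&& homogeneous 2 (comb_interior a phi_std),
    homogeneous 1 (comb_interior b (comb_interior a phi_std)) &
    homogeneous 0 (contract3 a b c phi_std)].
  move: a b c a7 b7 c7.
  suff /allP h : all (fun a => all (fun b => all (fun c =>
    [&& homogeneous 2 (comb_interior a phi_std),
    homogeneous 1 (comb_interior b (comb_interior a phi_std)) &
    homogeneous 0 (contract3 a b c phi_std)]) (iota 0 7)) (iota 0 7)) (iota 0 7).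
    move=> a b c a7 b7 c7; have /h /allP ha : a \in iota 0 7 by rewrite mem_iota.
    have /ha /allP hb : b \in iota 0 7 by rewrite mem_iota.
    by apply: hb; rewrite mem_iota.
  by vm_compute.
rewrite frame_contract3 // /phi_entry.
elim: (contract3 _ _ _ _) h3 => [|t p IHp] /=; first by rewrite /denote big_nil.
move=> /andP[/nilP t0 hp]; rewrite /denote big_cons kformDE kformZE -/(denote f 0 p) IHp //.
by rewrite t0 monomial0E mulr1 intrD.
Qed.

Lemma big_ord_iota (T : nmodType) n (F : nat -> T) :
  \sum_(i < n) F i = \sum_(i <- iota 0 n) F i.
Proof. by rewrite -(big_mkord xpredT) /index_iota subn0. Qed.

Lemma star_phi_std (phi : kform V 3) (vol : kform V 7) :
  phi = denote f 3 phi_std -> vol = monomial f 7 (iota 0 7) ->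
  star_phi phi g vol = denote f 4 star_std.
Proof.
move=> phiE volE; apply: kform_ext => w; rewrite /star_phi.
have spanE v : v = \sum_(i < 7) g v (E i) *: E i.
  rewrite {1}(frame_sum fE v); apply: eq_bigr => i _; congr (_ *: _).
  rewrite (frame_dot fE gE) (bigD1 i) //= (frame_dual fE) // eqxx mulr1.
  rewrite big1 ?addr0 // => j ji.
  by rewrite (frame_dual fE) // (negbTE ji : (j == i :> nat) = false) mulr0.
rewrite (hodge_star_orthonormal (E := fun i : 'I_7 => E i)) //; last first.
- by move=> i j; rewrite gE.
- by rewrite volE; apply: multilinear_monomial.
- by rewrite phiE; apply: multilinear_denote.
pose F (T : 'I_3 -> 'I_7) : R := (phi (fun r => E (T r)) : R) *
  (vol (vjoin (fun r => E (T r)) w : 'I_(3 + 4) -> V) : R).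
rewrite -[X in _ * X]/(\sum_(T : {ffun 'I_3 -> 'I_7}) F T) big_ffun_cons.
pose w0 (T : Type) : 'I_0 -> T := fun i => False_rect _ (notF (ltn_ord i)).
rewrite (eq_bigr (fun a : 'I_7 => \sum_(b < 7) \sum_(c < 7)
  F (vcons a (vcons b (vcons c (w0 _)))))); last first.
  move=> a _; rewrite (big_ffun_cons (fun T => F (vcons a T))); apply: eq_bigr => b _.
  rewrite (big_ffun_cons (fun T => F (vcons a (vcons b T)))); apply: eq_bigr => c _.
  by rewrite (big_ffun0 (fun T => F (vcons a (vcons b (vcons c T)))) (w0 _)).
have EF (a b c : 'I_7) : F (vcons a (vcons b (vcons c (w0 _)))) =
  denote f 4 (if phi_entry a b c == 0 then [::]
    else comb_scale (phi_entry a b c) (contract3 a b c [:: (1, iota 0 7)])) w.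
  rewrite /F.
  have -> : (fun r => E (vcons a (vcons b (vcons c (w0 _))) r)) =
      vcons (E a) (vcons (E b) (vcons (E c) (w0 _))).
    have C k (i : 'I_7) (z : 'I_k -> 'I_7) :
        (fun r => E (vcons i z r)) = vcons (E i) (fun r => E (z r)).
      by apply/funext => r; case: (unliftP ord0 r) => [r'|] ->; rewrite ?vconsS ?vcons0.
    by rewrite !C; congr (vcons _ (vcons _ (vcons _ _))); apply/funext => -[].
  rewrite {1}phiE phi_entryE //.
  case: eqP => [->|_]; first by rewrite mul0r /denote big_nil.
  rewrite denote_scale kformZE; congr (_ * _).
  have -> : vol = denote f 7 [:: (1, iota 0 7)] by rewrite volE /denote big_seq1 scale1r.
  rewrite (vjoin_vcons (k := 2)) (vjoin_vcons (k := 1)) (vjoin_vcons (k := 0)) vjoin0.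
  have /andP[h1 h2] : homogeneous 6 (comb_interior a [:: (1, iota 0 7)]) &&
     homogeneous 5 (comb_interior b (comb_interior a [:: (1, iota 0 7)])).
    move: a b {c}.
    suff /allP h : all (fun a => all (fun b =>
      homogeneous 6 (comb_interior a [:: (1, iota 0 7)]) &&
      homogeneous 5 (comb_interior b (comb_interior a [:: (1, iota 0 7)])))
        (iota 0 7)) (iota 0 7).
      move=> a b; have /h /allP ha : (a : nat) \in iota 0 7 by rewrite mem_iota /=.
      by apply: ha; rewrite mem_iota /=.
    by vm_compute.
  by rewrite -(frame_contract3 (k := 4)) // -!interiorE.
rewrite (eq_bigr (fun a : 'I_7 => \sum_(b < 7) \sum_(c < 7)
  (denote f 4 (if phi_entry a b c == 0 then [::]
    else comb_scale (phi_entry a b c) (contract3 a b c [:: (1, iota 0 7)])) w : R))); last first.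
  by move=> a _; apply: eq_bigr => b _; apply: eq_bigr => c _; rewrite EF.
have -> : \sum_(a < 7) \sum_(b < 7) \sum_(c < 7)
  (denote f 4 (if phi_entry a b c == 0 then [::]
    else comb_scale (phi_entry a b c) (contract3 a b c [:: (1, iota 0 7)])) w : R)
  = denote f 4 star_terms w.
  rewrite /star_terms denote_flatten kform_sumE -big_ord_iota; apply: eq_bigr => a _.
  rewrite denote_flatten kform_sumE -big_ord_iota; apply: eq_bigr => b _.
  by rewrite denote_flatten kform_sumE -big_ord_iota.
rewrite (denote_eq f (q := comb_scale 6 star_std)); [|by vm_compute|by vm_compute|by vm_compute].
rewrite denote_scale kformZE mulrA [_^-1 * _](_ : _ = 1) ?mul1r //.
by rewrite rmorph_nat mulVf ?pnatr_eq0.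
Qed.

End StandardStar.

(** * Levi-Civita identities and orthonormal bases *)

Section LeviCivita.
Variable R : realType.
Local Notation eps := (levi_civita R).

Lemma levi_civita_cyc i j k : eps i j k = eps k i j.
Proof.
by case: i => [[|[|[|i]]] hi] //; case: j => [[|[|[|j]]] hj] //;
  case: k => [[|[|[|k]]] hk].
Qed.

Lemma det_mx33 (M : 'M[R]_3) (m : nat -> nat -> R) : (forall i j, M i j = m i j) ->
  \det M =
  m 0%N 0%N * (m 1%N 1%N * m 2%N 2%N - m 1%N 2%N * m 2%N 1%N)
  - m 0%N 1%N * (m 1%N 0%N * m 2%N 2%N - m 1%N 2%N * m 2%N 0%N)
  + m 0%N 2%N * (m 1%N 0%N * m 2%N 1%N - m 1%N 1%N * m 2%N 0%N).
Proof.
move=> Mm.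
rewrite (expand_det_row _ ord0) !big_ord_recl big_ord0 /cofactor.
rewrite !(expand_det_row _ ord0) !big_ord_recl !big_ord0 /cofactor.
by rewrite !det_mx11 !mxE !Mm /=; ring.
Qed.

Lemma levi_civita_det (M : 'M[R]_3) c a b :
  \sum_i M i c * \sum_j \sum_k eps i j k * (M j a * M k b) = eps c a b * \det M.
Proof.
pose m i j := M (inord i) (inord j).
have Mm i j : M i j = m i j by rewrite /m !inord_val.
rewrite (det_mx33 Mm); clearbody m.
rewrite !big_ord_recl !big_ord0 /= !Mm /levi_civita /= /bump /=.
case: c => [[|[|[|c]]] hc] //; case: a => [[|[|[|a]]] ha] //;
  case: b => [[|[|[|b]]] hb] //=; ring.
Qed.

(** The cofactor formula for the inverse: contracting the free index i with M gives
    eps_cab det M, and the inverse N undoes the contraction. *)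
Lemma levi_civita_inverse (M N : 'M[R]_3) i a b : M *m N = 1%:M ->
  \sum_j \sum_k eps i j k * (M j a * M k b) = \det M * \sum_l eps l a b * N l i.
Proof.
move=> MN; pose X i := \sum_j \sum_k eps i j k * (M j a * M k b); rewrite -/(X i).
have Xc c : \sum_i M i c * X i = eps c a b * \det M by exact: levi_civita_det.
transitivity (\sum_l N l i * \sum_i' M i' l * X i').
  under [RHS]eq_bigr do rewrite mulr_sumr.
  rewrite exchange_big (bigD1 i) //= [X in _ + X]big1 => [|i' i'i].
    rewrite addr0; have := congr1 (fun m : 'M[R]_3 => m i i) MN; rewrite !mxE eqxx => h.
    rewrite -[LHS]mul1r -[1]h mulr_suml; apply: eq_bigr => l _; ring.
  have := congr1 (fun m : 'M[R]_3 => m i' i) MN; rewrite !mxE (negbTE i'i) => h.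
  rewrite -[RHS](mul0r (X i')) -[0 in RHS]h mulr_suml; apply: eq_bigr => l _; ring.
by rewrite mulr_sumr; apply: eq_bigr => l _; rewrite Xc; ring.
Qed.

Lemma levi_civita_change (W : lmodType R) (M N : 'M[R]_3) (X : 'I_3 -> 'I_3 -> W) i :
  M *m N = 1%:M ->
  \sum_j \sum_k eps i j k *: (\sum_a \sum_b (M j a * M k b) *: X a b) =
  \det M *: \sum_l N l i *: \sum_a \sum_b eps l a b *: X a b.
Proof.
move=> MN.
transitivity (\sum_a \sum_b (\sum_j \sum_k eps i j k * (M j a * M k b)) *: X a b).
  under eq_bigr do under eq_bigr do rewrite scaler_sumr.
  under eq_bigr do rewrite exchange_big.
  rewrite exchange_big; apply: eq_bigr => a _ /=.
  under eq_bigr do under eq_bigr do rewrite scaler_sumr.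
  under eq_bigr do rewrite exchange_big.
  rewrite exchange_big; apply: eq_bigr => b _ /=.
  rewrite scaler_suml; apply: eq_bigr => j _.
  by rewrite scaler_suml; apply: eq_bigr => k _; rewrite scalerA.
rewrite scaler_sumr.
under [RHS]eq_bigr do rewrite !scaler_sumr.
rewrite [RHS]exchange_big; apply: eq_bigr => a _ /=.
under [RHS]eq_bigr do rewrite !scaler_sumr.
rewrite [RHS]exchange_big; apply: eq_bigr => b _ /=.
rewrite (levi_civita_inverse i a b MN) mulr_sumr scaler_suml.
by apply: eq_bigr => l _; rewrite !scalerA; congr (_ *: _); ring.
Qed.

End LeviCivita.

Section OrthonormalBasis.
Variables (R : realType) (V : vectType R) (g : {dot V for idfun}).

(** Gram-Schmidt as an induction: split off a unit vector of W and pass to its orthogonal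
    complement in W. *)
Lemma orthonormal_basis n (W : {vspace V}) : \dim W = n ->
  exists F : 'I_n -> V, [/\ forall i, F i \in W,
    forall i j, g (F i) (F j) = (i == j)%:R &
    forall v, v \in W -> v = \sum_i g v (F i) *: F i].
Proof.
elim: n W => [|n IHn] W dimW.
  exists (fun=> 0); split=> [[]//|[]//|v]; move/eqP: dimW; rewrite dimv_eq0 => /eqP ->.
  by rewrite memv0 big_ord0 => /eqP.
have W0 : W != 0%VS by rewrite -dimv_eq0 dimW.
have v0 : vpick W != 0 by rewrite vpick0.
pose x := (Num.sqrt (g (vpick W) (vpick W)))^-1 *: vpick W.
have xW : x \in W by rewrite memvZ ?memv_pick.
have xx : g x x = 1.
  have p := dot_gt0 g v0; rewrite dotZl dotZr mulrA -invfM -expr2 sqr_sqrtr ?ltW //.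
  by rewrite mulVf ?gt_eqF.
have xx0 : g x x != 0 by rewrite xx oner_neq0.
have xn : x \notin orthov g W by apply/mem_orthovPn; exists x => //; exact: xx0.
have dimW' : \dim (W :&: orthov g <[x]>) = n by rewrite -(eq_dim_orthov1 xn) dimW.
have [F [FW FF Fs]] := IHn _ dimW'.
have xF i : g x (F i) = 0.
  have := FW i; rewrite memv_cap => /andP[_ /mem_orthovP h].
  by rewrite dotC; apply: h; rewrite memv_line.
exists (vcons x F); split=> [i|i j|v vW].
- case: (unliftP ord0 i) => [k|] ->; rewrite ?vconsS ?vcons0 //.
  by have := FW k; rewrite memv_cap => /andP[].
- case: (unliftP ord0 i) => [k|] ->; case: (unliftP ord0 j) => [m|] ->;
    rewrite ?vconsS ?vcons0 ?xF ?[g _ x]dotC ?xF ?FF ?xx ?(inj_eq lift_inj) //.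
rewrite big_ord_recl vcons0; under eq_bigr do rewrite vconsS.
pose w := v - g v x *: x.
have wx : g w x = 0 by rewrite dotDl dotNl dotZl xx mulr1 subrr.
have wE : w \in (W :&: orthov g <[x]>)%VS.
  rewrite memv_cap; apply/andP; split; first by apply: memvB => //; apply: memvZ.
  apply/mem_orthovP => y /vlineP[c ->].
  by suff: g w (c *: x) = 0 by []; rewrite dotZr wx mulr0.
have := Fs _ wE; rewrite {1}/w => /eqP; rewrite subr_eq addrC => /eqP {1}->.
congr (_ + _); apply: eq_bigr => i _.
by rewrite /w dotDl dotNl dotZl xF mulr0 subr0.
Qed.

End OrthonormalBasis.

Section CovectorWedge.
Variables (R : realType) (V : vectType R).

Lemma wedge3_covectorE (h : 'I_3 -> 'Hom(V, R^o)) v :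
  (covector (h 0) ∧ covector (h 1) ∧ covector (h 2%:R) : kform V 3) v =
  \det (\matrix_(i, j) h i (v j)) :> R.
Proof.
pose h' n := h (inord n).
have E n (i : 'I_3) : n = i :> nat -> covector (h i) = monomial h' 1 [:: n].
  by move=> ->; rewrite -covector_monomial /h' inord_val.
rewrite (E 0%N) // (E 1%N) // (E 2%N) // !monomial_wedge //= /monomial.
congr (\det _); apply/matrixP => i j; rewrite !mxE /h'.
by case: i => [[|[|[|i]]] hi] //=; congr (h _ _); apply/val_inj; rewrite /= inordK.
Qed.

Lemma wedge3_lincomb (h c : 'I_3 -> 'Hom(V, R^o)) (M : 'M[R]_3) :
  (forall i, h i = \sum_l M i l *: c l) ->
  (covector (h 0) ∧ covector (h 1) ∧ covector (h 2%:R) : kform V 3) =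
  \det M *: (covector (c 0) ∧ covector (c 1) ∧ covector (c 2%:R) : kform V 3).
Proof.
move=> hc; apply: kform_ext => v; rewrite kformZE !wedge3_covectorE -det_mulmx.
congr (\det _); apply/matrixP => i j; rewrite !mxE hc sum_lfunE.
by apply: eq_bigr => l _; rewrite scale_lfunE !mxE.
Qed.

End CovectorWedge.

(** * The decomposition in an adapted frame *)

Definition eps_sign (i j k : nat) : int :=
  match i, j, k with
  | 0%N, 1%N, 2%N | 1%N, 2%N, 0%N | 2%N, 0%N, 1%N => 1
  | 2%N, 1%N, 0%N | 1%N, 0%N, 2%N | 0%N, 2%N, 1%N => -1
  | _, _, _ => 0
  end.

Definition comb_eps (l : nat) (F : nat -> nat -> combination) : combination :=
  flatten [seq flatten [seq comb_scale (eps_sign l a b) (F a b)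
    | b <- iota 0 3] | a <- iota 0 3].

(** For an orthonormal basis of U, completed to the adapted frame, the coframe reads
    alpha = - (e^0, e^1, e^2), beta = - e^3, theta = (e^4, e^5, e^6), and these are the forms
    omega_n = 1/2 eps_nab theta^ab - beta ∧ theta^n; the dual triple is their negative. *)
Definition omega_comb (n : nat) : combination :=
  nth [::] [:: [:: (1, [:: 5; 6]%N); (1, [:: 3; 4]%N)];
               [:: (1, [:: 6; 4]%N); (1, [:: 3; 5]%N)];
               [:: (1, [:: 4; 5]%N); (1, [:: 3; 6]%N)]] n.

Definition alpha_comb (l : nat) : combination := [:: (-1, [:: l])].
Definition beta_comb : combination := [:: (-1, [:: 3]%N)].
Definition theta_comb (l : nat) : combination := [:: (1, [:: (4 + l)%N])].

Section FrameIdentities.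
Variables (R : realType) (V : vectType R) (f : nat -> 'Hom(V, R^o)).
Local Notation eps := (levi_civita R).
Local Notation den := (denote f).
Local Notation a0 l := (den 1 (alpha_comb l)).
Local Notation b0 := (den 1 beta_comb).
Local Notation t0 l := (den 1 (theta_comb l)).
Local Notation om0 n := (den 2 (omega_comb n)).

Lemma denoteN k p : den k (comb_scale (-1) p) = - den k p.
Proof. by rewrite denote_scale scaleN1r. Qed.

Lemma denote_half k p q : homogeneous k p -> homogeneous k q ->
  comb_eq p (comb_scale 2 q) -> 2^-1 *: den k p = den k q.
Proof.
move=> hp hq pq; rewrite (denote_eq f hp _ pq) ?denote_scale; last first.
  by rewrite /homogeneous /comb_scale all_map.
by rewrite scalerA rmorph_nat mulVf ?scale1r ?pnatr_eq0.
Qed.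

Lemma denote_eps k (l : 'I_3) (F : nat -> nat -> combination) :
  \sum_(a < 3) \sum_(b < 3) eps l a b *: den k (F a b) = den k (comb_eps l F).
Proof.
have epsE (a b : 'I_3) : eps l a b = (eps_sign l a b)%:~R.
  by case: l => [[|[|[|l]]] hl] //; case: a => [[|[|[|a]]] ha] //;
    case: b => [[|[|[|b]]] hb].
rewrite /comb_eps denote_flatten -big_ord_iota.
apply: eq_bigr => a _; rewrite denote_flatten -big_ord_iota.
by apply: eq_bigr => b _; rewrite epsE denote_scale.
Qed.

Lemma omega_frame (n : 'I_3) :
  2^-1 *: (\sum_(a < 3) \sum_(b < 3) eps n a b *: (t0 a ∧ t0 b)) - b0 ∧ t0 n = om0 n.
Proof.
under eq_bigr do under eq_bigr do rewrite denote_wedge //.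
rewrite (denote_eps _ _ (fun a b => comb_wedge (theta_comb a) (theta_comb b))).
rewrite denote_wedge //.
set T := comb_eps _ _; pose B := comb_wedge beta_comb (theta_comb n).
(* The first term of omega_n is its theta-part. *)
pose W : combination := [:: head (0, [::]) (omega_comb n)].
have /and5P[h1 h2 h3 h4 h5] : [&& homogeneous 2 T, homogeneous 2 W, comb_eq T (comb_scale 2 W),
   homogeneous 2 (W ++ comb_scale (-1) B) && homogeneous 2 (omega_comb n) &
   comb_eq (W ++ comb_scale (-1) B) (omega_comb n)].
  by rewrite /T /W /B; case: n {T B W} => [[|[|[|n]]] hn] //; vm_compute.
rewrite (denote_half h1 h2 h3) -denoteN -denote_cat.
by apply: denote_eq => //; case/andP: h4.
Qed.

Lemma omega_wedge_frame (n m : 'I_3) :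
  om0 n ∧ om0 m = (2 * (n == m)%:R : R) *: (den 3 [:: (1, [:: 4; 5; 6]%N)] ∧ b0).
Proof.
have h2 (i : 'I_3) : homogeneous 2 (omega_comb i) by case: i => [[|[|[|?]]] ?].
rewrite !denote_wedge //.
have -> : (2 * (n == m)%:R : R) = (2 * (n == m)%:R : int)%:~R by rewrite rmorphM /= !rmorph_nat.
rewrite -denote_scale; apply: denote_eq => //.
  by case: n => [[|[|[|?]]] ?] //; case: m => [[|[|[|?]]] ?] //; vm_compute.
by case: n => [[|[|[|?]]] ?] //; case: m => [[|[|[|?]]] ?] //; vm_compute.
Qed.

Lemma phi_frame : den 3 phi_std =
  - (a0 0%N ∧ a0 1%N ∧ a0 2%N : kform V 3) + \sum_(l < 3) (a0 l ∧ om0 l : kform V 3).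
Proof.
rewrite !denote_wedge // -denoteN.
under eq_bigr do rewrite denote_wedge //.
by rewrite !big_ord_recl big_ord0 addr0 -!denote_cat; apply: denote_eq; vm_compute.
Qed.

Lemma star_frame : den 4 star_std =
  - (b0 ∧ den 3 [:: (1, [:: 4; 5; 6]%N)] : kform V 4)
  - \sum_(l < 3) ((2^-1 *: \sum_(a < 3) \sum_(b < 3) eps l a b *: (a0 a ∧ a0 b)) ∧ om0 l
      : kform V 4).
Proof.
have S (l : 'I_3) : 2^-1 *: (\sum_(a < 3) \sum_(b < 3) eps l a b *: (a0 a ∧ a0 b)) =
    den 2 (nth [::] [:: [:: (1, [:: 1; 2]%N)]; [:: (1, [:: 2; 0]%N)]; [:: (1, [:: 0; 1]%N)]] l).
  under eq_bigr do under eq_bigr do rewrite denote_wedge //.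
  rewrite (denote_eps _ _ (fun a b => comb_wedge (alpha_comb a) (alpha_comb b))).
  by apply: denote_half; case: l => [[|[|[|?]]] ?] //; vm_compute.
under eq_bigr do rewrite S.
rewrite !big_ord_recl big_ord0 addr0 !denote_wedge // -!denote_cat -!denoteN -denote_cat.
by apply: denote_eq; vm_compute.
Qed.

Variables (E : nat -> V).
Hypothesis fE : dual_frame f E.

Lemma alpha_frame (l : 'I_3) :
  2^-1 *: (\sum_(a < 3) \sum_(b < 3)
    eps l a b *: (E (4 + b)%N ⌟ E (4 + a)%N ⌟ den 3 phi_std)) = a0 l.
Proof.
have i7 (i : 'I_3) : (4 + i < 7)%N by rewrite ltn_add2l.
have h (a : 'I_3) : homogeneous 2 (comb_interior (4 + a)%N phi_std) by case: a => [[|[|[|?]]] ?].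
under eq_bigr do under eq_bigr do rewrite !(frame_interior fE) //.
rewrite (denote_eps _ _ (fun a b => comb_interior (4 + b)%N (comb_interior (4 + a)%N phi_std))).
by apply: denote_half; case: l => [[|[|[|?]]] ?] //; vm_compute.
Qed.

Lemma beta_frame : E 6 ⌟ E 5 ⌟ E 4 ⌟ den 4 star_std = b0.
Proof. by rewrite (frame_contract3 fE) //; apply: denote_eq; vm_compute. Qed.

End FrameIdentities.

(** * Change of basis of the isotropic subspace *)

Section AlternatingForms.
Variables (R : realType) (V : vectType R).

Lemma alternating_denote (f : nat -> 'Hom(V, R^o)) k p :
  is_alternating (denote f k p).
Proof.
split=> [|v i j ij vij]; first exact: multilinear_denote.
rewrite /denote kform_sumE big1 // => t _; rewrite kformZE /monomial.
rewrite -det_tr (determinant_alternate ij) ?mulr0 // => r.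
by rewrite !mxE vij.
Qed.

Lemma alternating_vjoin k l (a : kform V (k + l)) (w : 'I_l -> V) :
  is_alternating a -> is_alternating ((fun z => a (vjoin z w)) : kform V k).
Proof.
move=> [ma aa]; split=> [|v i j ij vij]; first exact: multilinear_vjoin.
apply: (aa _ (lshift l i) (lshift l j)).
  by rewrite (inj_eq (@lshift_inj _ _)).
by rewrite /vjoin !(unsplitK (inl _)).
Qed.

Lemma interior3E l (a : kform V (3 + l)) x y z w :
  (z ⌟ y ⌟ x ⌟ (a : kform V l.+3)) w =
  a (vjoin (fun r : 'I_3 => nth 0 [:: x; y; z] r) w).
Proof.
rewrite !interiorE.
pose w0 : 'I_0 -> V := fun i => False_rect _ (notF (ltn_ord i)).
have -> : (fun r : 'I_3 => nth 0 [:: x; y; z] r) = vcons x (vcons y (vcons z w0)).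
  apply/funext => r; case: (unliftP ord0 r) => [r1|] ->; rewrite ?vconsS ?vcons0 //.
  case: (unliftP ord0 r1) => [r2|] ->; rewrite ?vconsS ?vcons0 //.
  case: (unliftP ord0 r2) => [r3|] ->; rewrite ?vconsS ?vcons0 //.
  by case: r3.
by rewrite (vjoin_vcons (k := 2)) (vjoin_vcons (k := 1)) (vjoin_vcons (k := 0)) vjoin0.
Qed.

End AlternatingForms.

(** U is an arbitrary basis, with matrix P in the orthonormal one, and Q = P^-1. The lemmas
    below give the weights: alpha scales by det P * Q^T, theta by Q^T, beta by det P, omega by
    (det P)^-1 P and its dual by (det P)^-1 Q^T. *)
Section ChangeOfBasis.
Variables (R : realType) (V : vectType R) (g : {dot V for idfun}).
Variables (phi : kform V 3) (vol : kform V 7).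
Variables (f : nat -> 'Hom(V, R^o)) (E : nat -> V).
Hypothesis fE : dual_frame f E.
Hypothesis gE : forall i j, (i < 7)%N -> (j < 7)%N -> g (E i) (E j) = (i == j)%:R.
Hypothesis phiE : phi = denote f 3 phi_std.
Hypothesis starE : star_phi phi g vol = denote f 4 star_std.
Variables (U : 3.-tuple V) (theta : 'I_3 -> 'Hom(V, R^o)) (P Q : 'M[R]_3).
Hypothesis UE : forall i, tnth U i = \sum_j P i j *: E (4 + j)%N.
Hypothesis thetaE : forall i, theta i = \sum_l Q l i *: f (4 + l)%N.
Hypothesis PQ : P *m Q = 1%:M.

Local Notation eps := (levi_civita R).
Local Notation den := (denote f).
Local Notation a0 l := (den 1 (alpha_comb l)).
Local Notation b0 := (den 1 beta_comb).
Local Notation t0 l := (den 1 (theta_comb l)).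
Local Notation om0 n := (den 2 (omega_comb n)).
Local Notation t0123 := (den 3 [:: (1, [:: 4; 5; 6]%N)]).
Local Notation q := (\det P).

Let QP : Q *m P = 1%:M. Proof. exact: mulmx1C. Qed.

Let detPQ : \det P * \det Q = 1. Proof. by rewrite -det_mulmx PQ det1. Qed.

Lemma detP_neq0 : q != 0.
Proof. by apply/eqP => p0; move/eqP: detPQ; rewrite p0 mul0r eq_sym oner_eq0. Qed.

Let detQ : \det Q = q^-1.
Proof. by apply: (mulfI detP_neq0); rewrite detPQ divff // detP_neq0. Qed.

Let i7 (i : 'I_3) : (4 + i < 7)%N. Proof. by rewrite ltn_add2l. Qed.

Let q2q : (q ^+ 2)^-1 * q = q^-1.
Proof. by rewrite expr2 invfM mulfVK ?detP_neq0. Qed.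

Lemma gramU_adapted : gramU g U = P *m P^T.
Proof.
apply/matrixP => i j; rewrite !mxE !UE dot_suml; apply: eq_bigr => k _.
rewrite dotZl !mxE dot_sumr (bigD1 k) //= dotZr gE // eqxx mulr1 big1 ?addr0 // => l lk.
by rewrite dotZr gE // eqn_add2l eq_sym (negbTE lk : (l == k :> nat) = false) mulr0.
Qed.

Lemma det_gramU : \det (gramU g U) = q ^+ 2.
Proof. by rewrite gramU_adapted det_mulmx det_tr expr2. Qed.

Lemma invmx_gramU : invmx (gramU g U) = Q^T *m Q.
Proof.
have AB : gramU g U *m (Q^T *m Q) = 1%:M.
  by rewrite gramU_adapted mulmxA -(mulmxA P) -trmx_mul QP trmx1 mulmx1 PQ.
have [Au _] := mulmx1_unit AB.
by rewrite -[RHS](mulKmx Au) AB mulmx1.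
Qed.

Lemma interior2_lincomb (c d : 'I_3 -> R) (x : 'I_3 -> V) :
  (\sum_b d b *: x b) ⌟ (\sum_a c a *: x a) ⌟ phi =
  \sum_a \sum_b (c a * d b) *: (x b ⌟ x a ⌟ phi).
Proof.
have mphi : multilinear phi by rewrite phiE; apply: multilinear_denote.
apply: kform_ext => v; rewrite !interiorE vcons_lincomb // kform_sumE.
apply: eq_bigr => a _; rewrite -interiorE vcons_lincomb; last exact: multilinear_interior.
rewrite kform_sumE mulr_sumr; apply: eq_bigr => b _.
by rewrite kformZE mulrA.
Qed.

Lemma alphaU_adapted i : alphaU phi U i = q *: \sum_l Q l i *: a0 l.
Proof.
rewrite /alphaU.
under eq_bigr do under eq_bigr do rewrite !UE interior2_lincomb.
rewrite (levi_civita_change _ _ PQ) scalerA mulrC -scalerA scaler_sumr; congr (_ *: _).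
apply: eq_bigr => l _; rewrite scalerA mulrC -scalerA phiE.
by rewrite (alpha_frame fE).
Qed.

(** With its last argument fixed, the dual 4-form is an alternating 3-form, so its value on U
    is det P times its value on the orthonormal basis. *)
Lemma betaU_adapted : betaU phi g vol U = q *: b0.
Proof.
apply: kform_ext => w; rewrite kformZE /betaU starE (interior3E (l := 1)).
rewrite -(beta_frame fE) (interior3E (l := 1)).
pose b : kform V 3 := fun z => den 4 star_std (vjoin z w : 'I_(3 + 1) -> V).
have altb : is_alternating b.
  by apply: (alternating_vjoin (l := 1)); apply: alternating_denote.
rewrite -/(b _) -/(b _).
have -> : (fun r : 'I_3 => nth 0 [:: U`_0; U`_1; U`_2] r) =
    (fun r : 'I_3 => \sum_j P r j *: E (4 + j)%N).
  apply/funext => r; rewrite -UE (tnth_nth 0).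
  by case: r => [[|[|[|r]]] hr].
rewrite (alternating_top _ (fun j : 'I_3 => E (4 + j)%N)) //; congr (_ * _).
  by congr (\det _); apply/matrixP => i j; rewrite mxE.
by congr b; apply/funext => -[[|[|[|r]]] hr].
Qed.

Lemma covector_theta i : covector (theta i) = \sum_l Q l i *: t0 l.
Proof.
apply: kform_ext => v; rewrite kform_sumE /covector thetaE sum_lfunE.
apply: eq_bigr => l _; rewrite scale_lfunE kformZE /denote big_seq1 scale1r.
by rewrite -covector_monomial.
Qed.

Lemma thetaU123_adapted : thetaU123 theta = q^-1 *: t0123.
Proof.
rewrite /thetaU123 (wedge3_lincomb (M := Q^T) (c := fun l : 'I_3 => f (4 + l)%N)); last first.
  by move=> i; rewrite thetaE; apply: eq_bigr => l _; rewrite mxE.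
rewrite det_tr detQ; congr (_ *: _); rewrite /denote big_seq1 scale1r.
by rewrite !covector_monomial !monomial_wedge.
Qed.

Lemma thetaU2_sum i :
  \sum_j \sum_k eps i j k *: thetaU2 theta j k =
  q^-1 *: \sum_l P i l *: \sum_a \sum_b eps l a b *: (t0 a ∧ t0 b).
Proof.
have QtPt : Q^T *m P^T = 1%:M by rewrite -trmx_mul PQ trmx1.
have E2 j k : thetaU2 theta j k = \sum_a \sum_b (Q^T j a * Q^T k b) *: (t0 a ∧ t0 b).
  rewrite /thetaU2 !covector_theta wedge_suml; apply: eq_bigr => a _.
  rewrite wedgeZl wedge_sumr scaler_sumr; apply: eq_bigr => b _.
  by rewrite wedgeZr scalerA !mxE.
under eq_bigr do under eq_bigr do rewrite E2.
rewrite (levi_civita_change _ _ QtPt) det_tr detQ; congr (_ *: _).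
by apply: eq_bigr => l _; rewrite mxE.
Qed.

Lemma omegaU_adapted i :
  omegaU phi g vol U theta i = q^-1 *: \sum_l P i l *: om0 l.
Proof.
rewrite /omegaU thetaU2_sum betaU_adapted det_gramU gramU_adapted.
have -> : \sum_p (P *m P^T) i p *: ((q *: b0) ∧ covector (theta p) : kform V 2) =
    q *: \sum_l P i l *: (b0 ∧ t0 l : kform V 2).
  transitivity (q *: \sum_l (\sum_p (P *m P^T) i p * Q l p) *: (b0 ∧ t0 l : kform V 2)).
    under eq_bigr do rewrite covector_theta wedgeZl wedge_sumr scalerA mulrC -scalerA scaler_sumr.
    rewrite -scaler_sumr exchange_big; congr (_ *: _); apply: eq_bigr => l _ /=.
    by rewrite scaler_suml; apply: eq_bigr => p _; rewrite wedgeZr scalerA.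
  congr (_ *: _); apply: eq_bigr => l _; congr (_ *: _).
  have -> : \sum_p (P *m P^T) i p * Q l p = (P *m P^T *m Q^T) i l.
    by rewrite [RHS]mxE; apply: eq_bigr => p _; rewrite !mxE.
  by rewrite -mulmxA -trmx_mul QP trmx1 mulmx1.
rewrite [X in _ - X]scalerA q2q [X in X - _]scalerA [2^-1 * _]mulrC -[X in X - _]scalerA.
rewrite -scalerBr; congr (_ *: _).
rewrite scaler_sumr -sumrB; apply: eq_bigr => l _.
by rewrite -omega_frame scalerA mulrC -scalerA -scalerBr.
Qed.

Lemma omega_tildeU_adapted k :
  omega_tildeU phi g vol U theta k = - q^-1 *: \sum_l Q l k *: om0 l.
Proof.
rewrite /omega_tildeU betaU_adapted det_gramU invmx_gramU.
have -> : \sum_p \sum_q0 \sum_r (eps p q0 r * (Q^T *m Q) k p) *: thetaU2 theta q0 r =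
    q^-1 *: \sum_l Q l k *: \sum_a \sum_b eps l a b *: (t0 a ∧ t0 b).
  transitivity (\sum_p (Q^T *m Q) k p *: \sum_q0 \sum_r eps p q0 r *: thetaU2 theta q0 r).
    apply: eq_bigr => p _; rewrite scaler_sumr; apply: eq_bigr => q0 _.
    by rewrite scaler_sumr; apply: eq_bigr => r _; rewrite scalerA mulrC.
  under eq_bigr do rewrite thetaU2_sum scalerA mulrC -scalerA scaler_sumr.
  rewrite -scaler_sumr exchange_big; congr (_ *: _); apply: eq_bigr => l _ /=.
  under eq_bigr do rewrite scalerA.
  rewrite -scaler_suml; congr (_ *: _).
  have -> : \sum_p (Q^T *m Q) k p * P p l = (Q^T *m Q *m P) k l by rewrite [RHS]mxE.
  by rewrite -mulmxA QP mulmx1 mxE.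
rewrite wedgeZl [X in _ + X]scalerA q2q covector_theta wedge_sumr.
rewrite [X in - X + _]scalerA [2^-1 * _]mulrC -[X in - X + _]scalerA.
rewrite scaleNr -!scalerN -scalerDr; congr (_ *: _).
rewrite -sumrN scaler_sumr -big_split -[RHS]sumrN; apply: eq_bigr => l _ /=.
by rewrite -omega_frame wedgeZr scalerN scalerBr opprB addrC !scalerA [2^-1 * _]mulrC.
Qed.

End ChangeOfBasis.

(** * The decompositions and the wedge products of the triples *)

Section Conclusions.
Variables (R : realType) (V : vectType R) (g : {dot V for idfun}).
Variables (phi : kform V 3) (vol : kform V 7).
Variables (f : nat -> 'Hom(V, R^o)) (E : nat -> V).
Hypothesis fE : dual_frame f E.
Hypothesis gE : forall i j, (i < 7)%N -> (j < 7)%N -> g (E i) (E j) = (i == j)%:R.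
Hypothesis phiE : phi = denote f 3 phi_std.
Hypothesis starE : star_phi phi g vol = denote f 4 star_std.
Variables (U : 3.-tuple V) (theta : 'I_3 -> 'Hom(V, R^o)) (P Q : 'M[R]_3).
Hypothesis UE : forall i, tnth U i = \sum_j P i j *: E (4 + j)%N.
Hypothesis thetaE : forall i, theta i = \sum_l Q l i *: f (4 + l)%N.
Hypothesis PQ : P *m Q = 1%:M.

Local Notation eps := (levi_civita R).
Local Notation den := (denote f).
Local Notation a0 l := (den 1 (alpha_comb l)).
Local Notation b0 := (den 1 beta_comb).
Local Notation om0 n := (den 2 (omega_comb n)).
Local Notation t0123 := (den 3 [:: (1, [:: 4; 5; 6]%N)]).
Local Notation q := (\det P).

Let QP : Q *m P = 1%:M. Proof. exact: mulmx1C. Qed.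
Let q0 : q != 0. Proof. exact: (detP_neq0 PQ). Qed.
Let detQ : \det Q = q^-1.
Proof. by apply: (mulfI q0); rewrite -det_mulmx PQ det1 divff. Qed.

(** Contragredient changes of basis cancel in a contracted wedge product. *)
Lemma wedge_contract k m (a : 'I_3 -> kform V k) (b : 'I_3 -> kform V m)
    (M N : 'M[R]_3) : M *m N = 1%:M ->
  \sum_i (\sum_l M l i *: a l) ∧ (\sum_n N i n *: b n) = \sum_l a l ∧ b l.
Proof.
move=> MN; under eq_bigr do rewrite wedge_suml.
rewrite exchange_big; apply: eq_bigr => l _ /=.
under eq_bigr do rewrite wedgeZl -wedgeZr.
rewrite -wedge_sumr; congr (_ ∧ _).
under eq_bigr do rewrite scaler_sumr.
rewrite exchange_big (bigD1 l) //= [X in _ + X]big1 => [|n nl].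
  under eq_bigr do rewrite scalerA.
  rewrite -scaler_suml (_ : \sum_i _ = 1) ?scale1r ?addr0 //.
  by have := congr1 (fun m : 'M[R]_3 => m l l) MN; rewrite !mxE eqxx.
under eq_bigr do rewrite scalerA.
rewrite -scaler_suml (_ : \sum_i _ = 0) ?scale0r //.
by have := congr1 (fun m : 'M[R]_3 => m l n) MN; rewrite !mxE eq_sym (negbTE nl).
Qed.

Lemma alphaU_wedge3 : (alphaU phi U 0 ∧ alphaU phi U 1 ∧ alphaU phi U 2%:R : kform V 3) =
  q ^+ 2 *: (a0 0%N ∧ a0 1%N ∧ a0 2%N : kform V 3).
Proof.
pose c (l : 'I_3) := - f l.
pose h (i : 'I_3) := \sum_l (q *: Q^T) i l *: c l.
have aE (l : 'I_3) : a0 l = covector (c l).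
  apply: kform_ext => v; rewrite /denote big_seq1 -covector_monomial.
  by rewrite kformZE /covector /c opp_lfunE mulN1r.
have alE i : alphaU phi U i = covector (h i).
  rewrite (alphaU_adapted fE phiE UE PQ); apply: kform_ext => v.
  rewrite kformZE kform_sumE mulr_sumr /covector /h sum_lfunE.
  by apply: eq_bigr => l _; rewrite kformZE aE scale_lfunE !mxE mulrA.
rewrite !alE (wedge3_lincomb (M := q *: Q^T) (c := c)) //.
rewrite detZ det_tr detQ -!aE; congr (_ *: _).
by rewrite exprSr mulfK.
Qed.

Lemma phi_decomposition : phi =
  - ((\det (gramU g U))^-1 *:
      (alphaU phi U 0 ∧ alphaU phi U 1 ∧ alphaU phi U 2%:R : kform V 3))
  + \sum_i (alphaU phi U i ∧ omegaU phi g vol U theta i : kform V 3).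
Proof.
rewrite alphaU_wedge3 (det_gramU gE UE) scalerA mulVf ?expf_neq0 // scale1r.
rewrite {1}phiE phi_frame; congr (_ + _).
rewrite -(wedge_contract (fun l : 'I_3 => a0 l) (fun l : 'I_3 => om0 l) QP).
apply: eq_bigr => i _.
rewrite (alphaU_adapted fE phiE UE PQ) (omegaU_adapted fE gE starE UE thetaE PQ).
by rewrite wedgeZl wedgeZr scalerA divff // scale1r.
Qed.

Lemma star_decomposition : star_phi phi g vol =
  - (betaU phi g vol U ∧ thetaU123 theta : kform V 4)
  + 2^-1 *: \sum_i \sum_j \sum_k eps i j k *:
     (alphaU phi U i ∧ alphaU phi U j ∧ omega_tildeU phi g vol U theta k : kform V 4).
Proof.
rewrite (betaU_adapted fE starE UE) (thetaU123_adapted thetaE PQ).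
rewrite wedgeZl wedgeZr scalerA divff // scale1r starE star_frame; congr (_ + _).
have QtPt : (q *: Q^T) *m (q^-1 *: P^T) = 1%:M.
  by rewrite -scalemxAl -scalemxAr scalerA divff // scale1r -trmx_mul PQ trmx1.
pose S (l : 'I_3) := 2^-1 *: (\sum_(a < 3) \sum_(b < 3) eps l a b *: (a0 a ∧ a0 b)).
transitivity (\sum_k (2^-1 *: \sum_i \sum_j eps k i j *: (alphaU phi U i ∧ alphaU phi U j))
    ∧ omega_tildeU phi g vol U theta k : kform V 4); last first.
  transitivity (2^-1 *: \sum_k \sum_i \sum_j eps i j k *:
     (alphaU phi U i ∧ alphaU phi U j ∧ omega_tildeU phi g vol U theta k : kform V 4)).
    rewrite scaler_sumr; apply: eq_bigr => k _; rewrite wedgeZl wedge_suml.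
    congr (_ *: _); apply: eq_bigr => i _; rewrite wedge_suml.
    by apply: eq_bigr => j _; rewrite wedgeZl -levi_civita_cyc.
  congr (_ *: _); rewrite exchange_big; apply: eq_bigr => i _ /=.
  by rewrite exchange_big.
have PtQt : P^T *m Q^T = 1%:M by rewrite -trmx_mul QP trmx1.
rewrite -(wedge_contract S (fun l : 'I_3 => om0 l) PtQt) -sumrN.
apply: eq_bigr => k _; rewrite (omega_tildeU_adapted fE gE starE UE thetaE PQ).
have E2 i j : alphaU phi U i ∧ alphaU phi U j =
    \sum_(a < 3) \sum_(b < 3) ((q *: Q^T) i a * (q *: Q^T) j b) *: (a0 a ∧ a0 b).
  rewrite !(alphaU_adapted fE phiE UE PQ) !scaler_sumr wedge_suml.
  apply: eq_bigr => a _; rewrite scalerA wedgeZl wedge_sumr scaler_sumr.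
  apply: eq_bigr => b _; rewrite !wedgeZr !scalerA !mxE; congr (_ *: _); ring.
have -> : 2^-1 *: (\sum_i \sum_j eps k i j *: (alphaU phi U i ∧ alphaU phi U j)) =
    q *: \sum_l P^T l k *: S l.
  under eq_bigr do under eq_bigr do rewrite E2.
  rewrite (levi_civita_change _ _ QtPt) detZ det_tr detQ !scaler_sumr.
  apply: eq_bigr => l _; rewrite !mxE /S !scalerA; congr (_ *: _).
  by field.
rewrite (_ : \sum_n Q^T k n *: _ = \sum_l Q l k *: om0 l); last first.
  by apply: eq_bigr => l _; rewrite mxE.
by rewrite wedgeZl wedgeZr scalerA mulrN divff // scaleN1r.
Qed.

Lemma theta_beta : (thetaU123 theta ∧ betaU phi g vol U : kform V 4) = t0123 ∧ b0.
Proof.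
rewrite (betaU_adapted fE starE UE) (thetaU123_adapted thetaE PQ).
by rewrite wedgeZl wedgeZr scalerA mulVf // scale1r.
Qed.

Lemma lincomb_wedge (c : R) (M : 'M[R]_3) (w : 'I_3 -> kform V 2) :
  (forall i, w i = c *: \sum_l M i l *: om0 l) ->
  forall i j, (w i ∧ w j : kform V 4) = (2 * c ^+ 2 * (M *m M^T) i j) *:
    (thetaU123 theta ∧ betaU phi g vol U : kform V 4).
Proof.
move=> wE i j; rewrite theta_beta !wE wedgeZl wedgeZr scalerA -expr2.
rewrite [2 * _ * _](_ : _ = c ^+ 2 * (2 * (M *m M^T) i j)); last by ring.
rewrite -[RHS]scalerA; congr (_ *: _).
rewrite wedge_suml mxE mulr_sumr scaler_suml; apply: eq_bigr => l _.
rewrite wedgeZl wedge_sumr scaler_sumr (bigD1 l) //= big1 => [|n nl]; last first.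
  by rewrite wedgeZr omega_wedge_frame eq_sym (negbTE nl) mulr0 scale0r !scaler0.
rewrite wedgeZr omega_wedge_frame eqxx mulr1 addr0 !scalerA !mxE.
by congr (_ *: _); ring.
Qed.

Lemma omegaU_wedge i j :
  (omegaU phi g vol U theta i ∧ omegaU phi g vol U theta j : kform V 4) =
  (2 * (\det (gramU g U))^-1 * gramU g U i j) *: (thetaU123 theta ∧ betaU phi g vol U).
Proof.
rewrite (lincomb_wedge (c := q^-1) (M := P)); last first.
  exact: (omegaU_adapted fE gE starE UE thetaE PQ).
by rewrite (det_gramU gE UE) exprVn (gramU_adapted gE UE).
Qed.

Lemma omega_tildeU_wedge i j :
  (omega_tildeU phi g vol U theta i ∧ omega_tildeU phi g vol U theta j : kform V 4) =
  (2 * (\det (gramU g U))^-1 * invmx (gramU g U) i j) *: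
    (thetaU123 theta ∧ betaU phi g vol U).
Proof.
rewrite (lincomb_wedge (c := - q^-1) (M := Q^T)); last first.
  move=> k; rewrite (omega_tildeU_adapted fE gE starE UE thetaE PQ).
  by congr (_ *: _); apply: eq_bigr => l _; rewrite mxE.
by rewrite (det_gramU gE UE) sqrrN exprVn (invmx_gramU gE UE PQ) trmxK.
Qed.

End Conclusions.

(** * Definiteness *)

Lemma mulmx_tr_gt0 (R : realType) n (M : 'M[R]_n) (x : 'rV[R]_n) :
  M \in unitmx -> x != 0 -> 0 < (x *m (M *m M^T) *m x^T) 0 0.
Proof.
move=> Mu x0; have y0 : x *m M != 0.
  by apply: contraNneq x0 => xM; rewrite -(mulmxK Mu x) xM mul0mx.
have -> : x *m (M *m M^T) *m x^T = (x *m M) *m (x *m M)^T by rewrite trmx_mul !mulmxA.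
have [i yi] : exists i, (x *m M) 0 i != 0.
  apply/existsP; apply: contraNT y0 => /existsPn h.
  by apply/eqP/rowP => i; rewrite [RHS]mxE; apply/eqP; rewrite -[_ == _]negbK h.
rewrite mxE (bigD1 i) //= ltr_wpDr //.
  by apply: sumr_ge0 => j _; rewrite [_^T _ _]mxE -expr2 sqr_ge0.
by rewrite [_^T _ _]mxE -expr2 exprn_even_gt0.
Qed.

Section Kernel.
Variables (R : realType) (V : vectType R) (phi : kform V 3).
Variables (f : nat -> 'Hom(V, R^o)) (E : nat -> V).
Hypothesis fE : dual_frame f E.
Hypothesis phiE : phi = denote f 3 phi_std.
Variables (U : 3.-tuple V) (P Q : 'M[R]_3).
Hypothesis UE : forall i, tnth U i = \sum_j P i j *: E (4 + j)%N.
Hypothesis PQ : P *m Q = 1%:M.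

Lemma mem_KU v : (v \in KU phi U) = [forall l : 'I_3, f l v == 0].
Proof.
pose h (i : 'I_3) : 'Hom(V, R^o) := \det P *: \sum_(l < 3) Q l i *: - f l.
have hE i : linfun (fun v : V => alphaU phi U i (fun=> v)) = h i.
  have -> : (fun v : V => alphaU phi U i (fun=> v)) = (h i : V -> R^o).
    apply/funext => u; rewrite (alphaU_adapted fE phiE UE PQ) kformZE kform_sumE.
    rewrite /h scale_lfunE sum_lfunE; congr (_ * _); apply: eq_bigr => l _.
    rewrite kformZE scale_lfunE opp_lfunE /denote big_seq1 kformZE -covector_monomial.
    by rewrite /covector mulN1r.
  by apply/lfunP => u; rewrite lfunE.
have -> : (v \in KU phi U) = [forall i : 'I_3, h i v == 0].
  rewrite memvE; apply/subv_bigcapP/forallP => H i.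
    by have := H i isT; rewrite hE -memvE memv_ker.
  by move=> _; rewrite hE -memvE memv_ker.
apply/forallP/forallP => H l; last first.
  rewrite /h scale_lfunE sum_lfunE big1 ?scaler0 // => m _.
  by rewrite scale_lfunE opp_lfunE (eqP (H m)) oppr0 scaler0.
have QP : Q *m P = 1%:M by exact: mulmx1C.
have hl i : \sum_(m < 3) Q m i * f m v = 0.
  have /eqP := H i; rewrite /h scale_lfunE sum_lfunE => h0; apply/eqP.
  have := mulf_eq0 (\det P) (- \sum_(m < 3) Q m i * f m v).
  rewrite (negbTE (detP_neq0 PQ)) oppr_eq0 /= => <-; apply/eqP.
  rewrite -[RHS]h0; congr (_ * _); rewrite -sumrN; apply: eq_bigr => m _.
  by rewrite scale_lfunE opp_lfunE; exact: esym (mulrN _ _).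
apply/eqP; transitivity (\sum_i P i l * \sum_(m < 3) Q m i * f m v); last first.
  by rewrite big1 // => i _; rewrite hl mulr0.
under eq_bigr do rewrite mulr_sumr.
rewrite exchange_big /= (bigD1 l) //= [X in _ + X]big1 => [|m ml].
  rewrite addr0; under eq_bigr do rewrite mulrA [P _ _ * _]mulrC.
  rewrite -mulr_suml; have := congr1 (fun m : 'M[R]_3 => m l l) QP.
  by rewrite !mxE eqxx => ->; rewrite mul1r.
under eq_bigr do rewrite mulrA [P _ _ * _]mulrC.
rewrite -mulr_suml; have := congr1 (fun M : 'M[R]_3 => M m l) QP.
by rewrite !mxE (negbTE ml) => ->; rewrite mul0r.
Qed.

Let i7 (i : 'I_4) : (3 + i < 7)%N. Proof. by rewrite ltn_add2l. Qed.

Lemma frame_mem_KU (i : 'I_4) : E (3 + i)%N \in KU phi U.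
Proof.
rewrite mem_KU; apply/forallP => l; rewrite (frame_dual fE) //.
by rewrite ltn_eqF //= (leq_trans (ltn_ord l)) ?leq_addr.
Qed.

Lemma KU_sum v : v \in KU phi U -> v = \sum_(i < 4) f (3 + i)%N v *: E (3 + i)%N.
Proof.
rewrite mem_KU => /forallP fv; rewrite {1}(frame_sum fE v).
rewrite -[7%N]/(3 + 4)%N big_split_ord /= big1 ?add0r // => l _.
by rewrite (eqP (fv l)) scale0r.
Qed.

Lemma dim_KU : \dim (KU phi U) = 4%N.
Proof.
pose B := [tuple E (3 + i)%N | i < 4].
suff : basis_of (KU phi U) B by apply: size_basis.
rewrite /basis_of eqEsubv -andbA; apply/and3P; split.
- by apply/span_subvP => v /tnthP[i ->]; rewrite tnth_mktuple frame_mem_KU.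
- apply/subvP => v /KU_sum ->; apply: memv_suml => i _; apply: memvZ.
  by apply: memv_span; apply/tnthP; exists i; rewrite tnth_mktuple.
apply/freeP => k k0 i.
have : \sum_(j < 4) k j *: E (3 + j)%N = 0.
  by rewrite -[RHS]k0; apply: eq_bigr => j _; rewrite -tnth_nth tnth_mktuple.
move=> /(congr1 (f (3 + i)%N)); rewrite linear0 linear_sum (bigD1 i) //= linearZ /=.
rewrite (frame_dual fE) // eqxx big1 => [|j ji]; first by rewrite addr0 => <-; rewrite [RHS]mulr1.
rewrite linearZ /= (frame_dual fE) // eqn_add2l.
by rewrite eq_sym (negbTE ji : (j == i :> nat) = false) scaler0.
Qed.

(** K_U is spanned by E_3, .., E_6. There mu is c e^3456, where c is its value on these
    vectors, and t ∧ b is e^3456 itself; so the matrix of the triple is c^-1 S. *)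
Lemma definite_triple_KU (w : 'I_3 -> kform V 2) (S : 'M[R]_3) :
  (forall i j, (w i ∧ w j : kform V 4) =
     (2 * S i j) *: (denote f 3 [:: (1, [:: 4; 5; 6]%N)] ∧ denote f 1 beta_comb : kform V 4)) ->
  (forall x : 'rV[R]_3, x != 0 -> 0 < (x *m S *m x^T) 0 0) ->
  definite_triple (KU phi U) w.
Proof.
move=> wS Spos; split=> [|mu altmu mu0]; first exact: dim_KU.
pose x (i : 'I_4) := vsproj (KU phi U) (E (3 + i)%N).
pose c : R := mu x.
pose D (v : 'I_4 -> subvs_of (KU phi U)) : R :=
  \det (\matrix_(r, i) f (3 + i)%N (vsval (v r))).
have muE v : mu v = D v * c :> R.
  have vE : v = fun r => \sum_(i < 4) f (3 + i)%N (vsval (v r)) *: x i.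
    apply/funext => r; apply/val_inj; rewrite /= linear_sum [LHS]KU_sum ?subvsP //.
    by apply: eq_bigr => i _; rewrite linearZ /= vsprojK ?frame_mem_KU.
  by rewrite {1}vE alternating_top.
have c0 : c != 0.
  apply/eqP => c0; apply: mu0; apply: kform_ext => v.
  by rewrite muE c0 mulr0.
exists (c^-1 *: S) => [i j|].
  apply: kform_ext => v; rewrite /restrict_form wS !kformZE muE mxE.
  have -> : 2 * (c^-1 * S i j) * (D v * c) = 2 * S i j * D v by field.
  congr (_ * _); rewrite denote_wedge // (denote_eq f (q := [:: (1, [:: 3; 4; 5; 6]%N)])) //.
  rewrite /denote big_seq1 scale1r /monomial /D -det_tr; congr (\det _).
  by apply/matrixP => r k; rewrite !mxE; congr (f _ _); case: k => [[|[|[|[|k]]]] hk].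
have Ec (y : 'rV[R]_3) : (y *m (c^-1 *: S) *m y^T) 0 0 = c^-1 * (y *m S *m y^T) 0 0.
  by rewrite -scalemxAr -scalemxAl mxE.
have [cp|cn|/eqP] := ltgtP 0 c; last by rewrite eq_sym (negbTE c0).
- by left=> y y0; rewrite Ec mulr_gt0 ?invr_gt0 ?Spos.
- by right=> y y0; rewrite Ec nmulr_rlt0 ?invr_lt0 ?Spos.
Qed.

End Kernel.

(** The exponents match since 7/6 + 1/3 - 1/2 = 1 and 11/6 - 1/3 - 1/2 = 1. *)
Lemma powR_rescale (R : realType) (d a : R) : 0 < d ->
  2 * d `^ (- (7%:R / 6%:R)) * (a / d `^ (3%:R^-1)) * Num.sqrt d = 2 * d^-1 * a /\
  2 * d `^ (- (11%:R / 6%:R)) * (a / d `^ (- 3%:R^-1)) * Num.sqrt d = 2 * d^-1 * a.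
Proof.
move=> d0; have dD r s : d `^ (r + s) = d `^ r * d `^ s.
  by rewrite powRD // (gt_eqF d0) implybT.
rewrite -(powR12_sqrt (ltW d0)) -!powRN -(powR_inv1 (ltW d0)); split.
- have <- : - (7%:R / 6%:R) + - 3%:R^-1 + 2^-1 = - 1 :> R by field.
  by rewrite !dD; ring.
- have <- : - (11%:R / 6%:R) + - - 3%:R^-1 + 2^-1 = - 1 :> R by field.
  by rewrite !dD; ring.
Qed.

Theorem lemma2p2 (R : realType) (V : vectType R)
    (hV : \dim (fullv : {vspace V}) = 7%N)
    (phi : kform V 3) (hphi : linear_G2_structure phi)
    (g : {dot V for idfun}) (vol : kform V 7)
    (hg : G2_metric_volume phi g vol)
    (UU : {vspace V}) (hUdim : \dim UU = 3%N) (hUiso : isotropic phi UU)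
    (U : 3.-tuple V) (hU : basis_of UU U)
    (theta : 'I_3 -> 'Hom(V, R^o)) (htheta : dual_coframe g U theta) :
  let A := gramU g U in
  let d := \det A in
  let al := alphaU phi U in
  let be := betaU phi g vol U in
  let t123 := thetaU123 theta in
  let volU := vol_U g U theta in
  let om := omegaU phi g vol U theta in
  let omt := omega_tildeU phi g vol U theta in
  [/\ phi = - (d^-1 *: (al 0 ∧ al 1 ∧ al 2%:R : kform V 3))
            + \sum_i (al i ∧ om i : kform V 3),
      star_phi phi g vol =
        - (be ∧ t123 : kform V 4)
        + 2^-1 *: \sum_i \sum_j \sum_k
            levi_civita R i j k *: (al i ∧ al j ∧ omt k : kform V 4),
      (forall i j : 'I_3,
         (om i ∧ om j : kform V 4) = (2 * d^-1 * A i j) *: (t123 ∧ be) /\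
         (om i ∧ om j : kform V 4) =
           (2 * d `^ (- (7%:R / 6%:R)) * (A i j / d `^ (3%:R^-1))) *:
             (volU ∧ be)),
      (forall i j : 'I_3,
         (omt i ∧ omt j : kform V 4) =
           (2 * d^-1 * invmx A i j) *: (t123 ∧ be) /\
         (omt i ∧ omt j : kform V 4) =
           (2 * d `^ (- (11%:R / 6%:R)) * (invmx A i j / d `^ (- 3%:R^-1))) *:
             (volU ∧ be)) &
      definite_triple (KU phi U) om /\ definite_triple (KU phi U) omt].
Proof.
have [F [FU FF Fs]] := orthonormal_basis g hUdim.
have [f0 [E0 [fE0 phi0]]] := G2_standard_frame hV hphi.
have [gE0 _] := G2_metric_volume_frame fE0 phi0 hg.
have phiF : phi (fun i => nth 0 [:: F 0; F 1; F 2%:R] i) = 0.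
  have := congr1 (fun a : kform (subvs_of UU) 3 => a (fun i => vsproj UU (F i)) : R) hUiso.
  rewrite /restrict_form => h; rewrite -[RHS]h; congr phi; apply/funext => i.
  rewrite vsprojK //.
  by case: i => [[|[|[|i]]] hi] //=; congr F; apply/val_inj.
have [f [E [fE phiE [E4 E5 E6]]]] := adapted_frame fE0 gE0 phi0
  (FF 0 0) (FF 1 1) (FF 2%:R 2%:R) (FF 0 1) (FF 1 2%:R) (FF 2%:R 0) phiF.
(* Applied again, in the adapted frame, to identify vol there. *)
have [gE volE] := G2_metric_volume_frame fE phiE hg.
have starE := star_phi_std fE gE phiE volE.
have EF (j : 'I_3) : E (4 + j)%N = F j.
  by case: j => [[|[|[|j]]] hj] //=; rewrite ?E4 ?E5 ?E6; congr F; apply/val_inj.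
(* Q is the inverse of P because theta is dual to U. *)
pose P : 'M[R]_3 := \matrix_(i, j) g (tnth U i) (F j).
pose Q : 'M[R]_3 := \matrix_(l, i) theta i (F l).
have UE i : tnth U i = \sum_j P i j *: E (4 + j)%N.
  rewrite [LHS]Fs; last by rewrite (basis_mem hU) ?mem_tnth.
  by apply: eq_bigr => j _; rewrite mxE EF.
have [thetaU theta0] := htheta.
have thetaE i : theta i = \sum_l Q l i *: f (4 + l)%N.
  apply/lfunP => v; rewrite sum_lfunE {1}(frame_sum fE v) linear_sum.
  rewrite -[7%N]/(4 + 3)%N big_split_ord /= big1 ?add0r => [|k _]; last first.
    rewrite linearZ /= theta0 ?scaler0 //; apply/mem_orthovP => y.
    rewrite (span_basis hU) => /Fs ->.
    suff: g (E k) (\sum_j g y (F j) *: F j) = 0 by [].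
    rewrite dot_sumr big1 // => j _; rewrite dotZr -EF gE ?ltn_add2l //; last first.
      by apply: leq_trans (ltn_ord k) _.
    by rewrite ltn_eqF ?mulr0 // (leq_trans (ltn_ord k)) ?leq_addr.
  apply: eq_bigr => l _; rewrite linearZ /= scale_lfunE mxE EF.
  exact: mulrC.
have PQ : P *m Q = 1%:M.
  apply/matrixP => i j; rewrite !mxE eq_sym -thetaU UE linear_sum.
  by apply: eq_bigr => l _; rewrite linearZ /= EF !mxE.
have dE := det_gramU gE UE; have q0 := detP_neq0 PQ.
have d0 : 0 < \det (gramU g U) by rewrite dE exprn_even_gt0.
move=> A d al be t123 volU om omt.
have volUE : (volU ∧ be : kform V 4) = Num.sqrt d *: (t123 ∧ be : kform V 4).
  by rewrite /volU /vol_U wedgeZl.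
have omE := omegaU_wedge fE gE starE UE thetaE PQ.
have omtE := omega_tildeU_wedge fE gE starE UE thetaE PQ.
split.
- exact: (phi_decomposition fE gE phiE starE UE thetaE PQ).
- exact: (star_decomposition fE gE phiE starE UE thetaE PQ).
- move=> i j; split; first exact: omE.
  by rewrite volUE scalerA (powR_rescale _ d0).1; exact: omE.
- move=> i j; split; first exact: omtE.
  by rewrite volUE scalerA (powR_rescale _ d0).2; exact: omtE.
have [Pu Qu] := mulmx1_unit PQ.
split.
- apply: (definite_triple_KU fE phiE UE PQ (S := d^-1 *: A)) => [i j|x x0].
    rewrite (_ : (d^-1 *: A) i j = d^-1 * A i j); last by rewrite mxE.
    by rewrite omE (theta_beta fE starE UE thetaE PQ) mulrA.
  rewrite -scalemxAr -scalemxAl mxE mulr_gt0 ?invr_gt0 //.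
  by rewrite /A (gramU_adapted gE UE) mulmx_tr_gt0.
- apply: (definite_triple_KU fE phiE UE PQ (S := d^-1 *: invmx A)) => [i j|x x0].
    rewrite (_ : (d^-1 *: invmx A) i j = d^-1 * invmx A i j); last by rewrite mxE.
    by rewrite omtE (theta_beta fE starE UE thetaE PQ) mulrA.
  rewrite -scalemxAr -scalemxAl mxE mulr_gt0 ?invr_gt0 //.
  rewrite /A (invmx_gramU gE UE PQ) -{2}[Q]trmxK.
  by rewrite mulmx_tr_gt0 // unitmx_tr.
Qed.
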